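(* Let $F_1,F_2$ be as in the context (so $F_1,F_2$ are Lipschitz continuous), and let $u_0:\mathbb R^N\to\mathbb R$ be bounded and Lipschitz continuous. Let $u$ be the viscosity solution of $$u_t+F_1(D^2u)+F_2(D^2u)=0\ \text{ in }Q_T,\qquad u(0,\cdot)=u_0,$$ and let $u_h$ be defined on $\Delta t\{0,1,\dots,n_T\}\times\mathbb R^N$ (with $n_T\Delta t=T$) by the splitting scheme $$u_h(t_n,\cdot)=S_1(\Delta t)S_2(\Delta t)u_h(t_{n-1},\cdot),\quad n=1,\dots,n_T,\qquad u_h(0,\cdot)=u_0,\qquad t_n=n\Delta t.$$ Then there is a constant $C$, independent of $\Delta t$, such that $$-C\Delta t^{1/14}\le u-u_h\le C\Delta t^{1/6}\quad\text{in }\Delta t\{0,1,2,\dots,n_T\}\times\mathbb R^N.$$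
   Context: $T>0$, $Q_T=(0,T]\times\mathbb R^N$. For $j=1,2$ and $X$ a symmetric $N\times N$ matrix, $$F_j(X)=\sup_{\alpha\in\mathcal A}\{-\mathrm{tr}[a_j^\alpha X]-f_j^\alpha\},$$ where $\mathcal A$ is a nonempty set, $a_j^\alpha$ are symmetric positive semidefinite $N\times N$ matrices and $f_j^\alpha$ real numbers, both bounded uniformly in $\alpha$ and independent of $(t,x)$. For $j=1,2$, $S_j(t)\phi$ denotes the value at time $t$ of the unique bounded viscosity solution of $v_t+F_j(D^2v)=0$ in $(0,\infty)\times\mathbb R^N$ with initial value $\phi$ (for $\phi$ bounded and Lipschitz continuous); $S_j(t)$ maps bounded Lipschitz functions to bounded Lipschitz functions. *)

(* Defs.v *)
From HB Require Import structures.
From mathcomp Require Import all_boot all_order all_algebra.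
From mathcomp Require Import all_classical all_reals all_analysis.

Set Implicit Arguments.
Unset Strict Implicit.
Unset Printing Implicit Defensive.
Import Order.TTheory GRing.Theory Num.Theory.
Import numFieldNormedType.Exports.

Local Open Scope classical_set_scope.
Local Open Scope ring_scope.

(** Points of space-time are pairs [z = (t, x) : R * 'rV[R]_N]. The norm of
    ['rV[R]_N] and ['M[R]_N] is the maximum norm of the library; boundedness,
    continuity and Lipschitz continuity do not depend on the choice of norm. *)

Definition psdmx (R : realType) (N : nat) (a : 'M[R]_N) : Prop :=
  a^T = a /\ forall xi : 'rV[R]_N, 0 <= (xi *m a *m xi^T) 0 0.

(** [sup] is the supremum in [R] (junk value 0 on unbounded sets): it is the
    intended one when [A] is nonempty and [a], [f] are bounded. *)
Definition bellman (R : realType) (N : nat) (A : Type)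
    (a : A -> 'M[R]_N) (f : A -> R) (X : 'M[R]_N) : R :=
  sup (range (fun alpha => - \tr (a alpha *m X) - f alpha)).

Definition time_dir (R : realType) (N : nat) : R * 'rV[R]_N := (1, 0).

Definition space_dir (R : realType) (N : nat) (i : 'I_N) : R * 'rV[R]_N :=
  (0, delta_mx 0 i).

Definition time_derivative (R : realType) (N : nat)
    (phi : R * 'rV[R]_N -> R) : R * 'rV[R]_N -> R :=
  fun z => 'D_(time_dir R N) phi z.

Definition partial (R : realType) (N : nat) (i : 'I_N)
    (phi : R * 'rV[R]_N -> R) : R * 'rV[R]_N -> R :=
  fun z => 'D_(space_dir R i) phi z.

Definition hessian (R : realType) (N : nat)
    (phi : R * 'rV[R]_N -> R) (z : R * 'rV[R]_N) : 'M[R]_N :=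
  \matrix_(i, j) partial j (partial i phi) z.

(** Test functions are of class C^{1,2} on the whole of R x R^N; since only
    local extrema are tested, a cut-off shows that this is no restriction. *)
Definition C12 (R : realType) (N : nat) (phi : R * 'rV[R]_N -> R) : Prop :=
  [/\ continuous phi,
      (forall z, derivable phi z (time_dir R N)) /\
        continuous (time_derivative phi),
      forall i : 'I_N,
        (forall z, derivable phi z (space_dir R i)) /\
        continuous (partial i phi)
    & forall i j : 'I_N,
        (forall z, derivable (partial i phi) z (space_dir R j)) /\
        continuous (partial j (partial i phi))].

(** For a set of times [I], the equation is posed on
    [I x R^N] and the solution lives on [({0} U I) x R^N]; values of functions
    elsewhere play no role. With [I = `]0, T]], extrema at the terminal time
    are extrema relative to [`]0, T] x R^N]. *)
Definition cylinder (R : realType) (N : nat) (I : set R) :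
    set (R * 'rV[R]_N) :=
  [set z | I z.1].

Definition visc_subsolution (R : realType) (N : nat) (F : 'M[R]_N -> R)
    (I : set R) (u : R * 'rV[R]_N -> R) : Prop :=
  forall (phi : R * 'rV[R]_N -> R) (z : R * 'rV[R]_N),
    C12 phi -> cylinder I z ->
    (\forall w \near within (cylinder I) (nbhs z),
        u w - phi w <= u z - phi z) ->
    time_derivative phi z + F (hessian phi z) <= 0.

Definition visc_supersolution (R : realType) (N : nat) (F : 'M[R]_N -> R)
    (I : set R) (u : R * 'rV[R]_N -> R) : Prop :=
  forall (phi : R * 'rV[R]_N -> R) (z : R * 'rV[R]_N),
    C12 phi -> cylinder I z ->
    (\forall w \near within (cylinder I) (nbhs z),
        u z - phi z <= u w - phi w) ->
    0 <= time_derivative phi z + F (hessian phi z).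

(** Bounded viscosity solution of [u_t + F(D^2 u) = 0] in [I x R^N],
    [u(0, .) = phi]. Boundedness is required on every time strip [[0, tau]],
    [tau] in [I]: for [I = `]0, T]] this is boundedness on [[0, T] x R^N],
    while for [I = `]0, +oo[] a bound uniform in time would be too much to ask,
    the solution with [phi = 0] being [- t F(0)]. *)
Definition bounded_visc_solution (R : realType) (N : nat) (F : 'M[R]_N -> R)
    (I : set R) (phi : 'rV[R]_N -> R) (u : R * 'rV[R]_N -> R) : Prop :=
  [/\ {within cylinder (0 |` I), continuous u},
      forall tau, I tau -> [bounded u z | z in cylinder `[0, tau]],
      forall x, u (0, x) = phi x,
      visc_subsolution F I u
    & visc_supersolution F I u].

(** Nothing is prescribed outside bounded Lipschitz initial values. *)
Definition solution_operator (R : realType) (N : nat) (F : 'M[R]_N -> R)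
    (S : R -> ('rV[R]_N -> R) -> 'rV[R]_N -> R) : Prop :=
  forall phi : 'rV[R]_N -> R,
    [bounded phi x | x in setT] -> [lipschitz phi x | x in setT] ->
    bounded_visc_solution F `]0, +oo[ phi (fun z => S z.1 phi z.2).

(** [splitting S1 S2 dt u0 n] is [u_h(t_n, .)] with [t_n = n dt]. *)
Fixpoint splitting (R : realType) (N : nat)
    (S1 S2 : R -> ('rV[R]_N -> R) -> 'rV[R]_N -> R) (dt : R)
    (u0 : 'rV[R]_N -> R) (n : nat) : 'rV[R]_N -> R :=
  if n is n'.+1 then S1 dt (S2 dt (splitting S1 S2 dt u0 n')) else u0.

(* Main.v *)
(** Write [h] for the time step. Both [u] and the splitting scheme are compared with
    the value functions [V_n = J^n u0] of controls that are constant on each time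
    step, where [J V] is the infimum over the pairs of controls [(alpha, beta)] of
    [P V + h (f1 alpha + f2 beta)] and [P] is a random walk, with steps much smaller
    than [h], approximating the diffusion with matrix [a1 alpha + a2 beta].

    Upper bounds: a subsolution of the Bellman equation is a subsolution of the
    linear equation of every single control, so freezing the control can only increase
    the value. This holds for [S1] and [S2] as well as for [u], and walks commute,
    hence [u] and the scheme are below [V_n], up to errors that vanish with the step
    of the walk.

    Lower bounds: [J] is an infimum of averages of translations, so a mollification
    [M] satisfies [M (J V) <= J (M V)], i.e. [M V_n] is a smooth subsolution of the
    scheme [J]. Near each point [M V_n] is above a quadratic polynomial minus a cubic
    error [K |y|^3], where [K] is of order [eps^-2]. Replacing the cube by a quartic
    gives an explicit strict subsolution, which can be used as a test function for
    viscosity supersolutions: only smooth functions are ever compared with viscosity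
    solutions, and doubling of variables is not needed. One step of [u], or of [S2]
    followed by [S1], therefore loses at most [h * sqrt h / eps^2] against [M V_n].
    With [eps = h^(1/6)] the total error is of order [h^(1/6)], on both sides. *)

Require Import Defs.
From HB Require Import structures.
From mathcomp Require Import all_boot all_order all_algebra.
From mathcomp Require Import all_classical all_reals all_analysis.
From mathcomp Require Import ring lra.
Import Order.TTheory GRing.Theory Num.Theory.
Import numFieldNormedType.Exports.
Local Open Scope classical_set_scope.
Local Open Scope ring_scope.

Set Implicit Arguments.
Unset Strict Implicit.
Unset Printing Implicit Defensive.

(** * Averages and mollification *)

Lemma is_derive_continuous (R : realType) (f : R -> R) (x df : R) :
  is_derive x 1 f df -> {for x, continuous f}.
Proof.
move=> [fx _]; apply: differentiable_continuous.
exact/derivable1_diffP.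
Qed.

Lemma is_derive_le (R : realType) (f g df dg : R -> R) (a b : R) : a <= b ->
  (forall x, a <= x <= b -> is_derive x 1 f (df x)) ->
  (forall x, a <= x <= b -> is_derive x 1 g (dg x)) ->
  (forall x, a <= x <= b -> df x <= dg x) ->
  f b - f a <= g b - g a.
Proof.
move=> ab fE gE dfg.
have hE x : a <= x <= b -> is_derive x 1 (g \- f) (dg x - df x).
  by move=> xab; have := fE x xab; have := gE x xab; exact: is_deriveB.
have [||c] := @MVT_segment R (g \- f) (dg \- df) a b ab.
- by move=> x; rewrite in_itv/= => /andP[/ltW ax /ltW xb]; apply: hE; rewrite ax.
- apply: continuous_in_subspaceT => x; rewrite inE/= in_itv/= => /hE.
  exact: is_derive_continuous.
rewrite in_itv/= => /dfg; rewrite -subr_ge0 => dc0 /= H.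
have : 0 <= (g b - f b) - (g a - f a) by rewrite H mulr_ge0// subr_ge0.
lra.
Qed.

Lemma is_derive_eq_diff (R : realType) (f g d : R -> R) (a b : R) :
  (forall x, a <= x <= b -> is_derive x 1 f (d x)) ->
  (forall x, a <= x <= b -> is_derive x 1 g (d x)) ->
  forall x y, a <= x <= b -> a <= y <= b -> f y - f x = g y - g x.
Proof.
move=> fE gE x y.
wlog xy : x y / x <= y.
  move=> H; case: (leP x y) => [xy|/ltW yx] xab yab; first exact: H.
  by have := H _ _ yx yab xab; lra.
move=> /andP[ax xb] /andP[ay yb].
have sub z : x <= z <= y -> a <= z <= b.
  by move=> /andP[xz zy]; rewrite (le_trans ax xz) (le_trans zy yb).
apply/eqP; rewrite eq_le; apply/andP; split; apply: (is_derive_le (df := d) (dg := d)) => // z /sub.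
all: by [exact: fE|exact: gE].
Qed.

Lemma antiderivative_gt (R : realType) (f : R -> R) (a : R) : continuous f ->
  exists F : R -> R, forall x : R, a < x -> is_derive x 1 F (f x).
Proof.
move=> cf.
exists (fun y => (\int[lebesgue_measure]_(t in `[a, y]) (f t))%R) => x ax.
have [||dF FE] := @continuous_FTC1_closed R f a x (x + 1) _ _ ax (cf x).
- by rewrite ltrDl.
- apply: continuous_compact_integrable; first exact: segment_compact.
  exact: continuous_subspaceT.
by split; [exact: dF|rewrite -derive1E].
Qed.

(** The integral from [- n] is an antiderivative only to the right of [- n]. Two such integrals
    differ by a constant on their common domain, so they can be glued after subtracting the value at
    0. *)
Lemma antiderivative (R : realType) (f : R -> R) : continuous f ->
  exists F : R -> R, forall x : R, is_derive x 1 F (f x).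
Proof.
move=> cf.
have /choice[G GE] : forall n : nat, exists F : R -> R,
    forall x : R, - n%:R < x -> is_derive x 1 F (f x).
  by move=> n; exact: antiderivative_gt.
pose n (x : R) := (Num.truncn `|x|).+1.
have nP x : `|x| < (n x)%:R by rewrite truncnS_gt.
pose F x := G (n x) x - G (n x) 0; exists F => x.
(* The extra unit leaves room around [x]: for [y] within 1 of [x] one still has [|y| < m], so near
   [x] the glued [F] is given by the single function [G m]. *)
pose m := (n x).+1.
have FE y : `|y| < m%:R -> F y = G m y - G m 0.
  move=> ym; rewrite /F.
  have yn := nP y.
  pose lo : R := Num.min 0 y; pose hi : R := Num.max 0 y.
  have lo0 : `|y| = hi - lo.
    by rewrite /lo /hi; have [y0|/ltW y0] := leP 0 y; [rewrite ger0_norm//|rewrite ler0_norm//]; lra.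
  have hi0 : 0 <= hi by rewrite le_max lexx.
  have lo1 : lo <= 0 by rewrite ge_min lexx.
  have bnd k z : `|y| < k%:R -> lo <= z -> - k%:R < z :> R by lra.
  apply: (is_derive_eq_diff (d := f) (a := lo) (b := hi)).
  - by move=> z /andP[z1 z2]; apply: GE; exact: bnd z1.
  - by move=> z /andP[z1 z2]; apply: GE; exact: bnd z1.
  - by rewrite lo1.
  - by rewrite /lo /hi ge_min le_max !lexx !orbT.
have : is_derive x 1 (fun y => G m y - G m 0) (f x).
  rewrite -[f x]subr0; apply: is_deriveB.
  apply: GE; have := nP x; have := ler_norm (- x); rewrite normrN /m -natr1; lra.
apply: near_eq_is_derive.
near=> y; apply/esym/FE.
have : `|x - y| < 1.
  by near: y; apply: nbhsx_ballx.
have := ler_distD x y 0; rewrite !subr0 distrC /m -natr1; have := nP x; lra.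
Unshelve. all: by end_near. Qed.

(* [eps^-1] times the integral of [g] over [[0, eps]], for continuous [g]. *)
Definition mean (R : realType) (eps : R) (g : R -> R) : R :=
  let F := xget (fun=> 0) [set F : R -> R | forall x : R, is_derive x 1 F (g x)]
  in (F eps - F 0) / eps.

Lemma mean_eq (R : realType) (eps : R) (g F : R -> R) : 0 < eps ->
  (forall x : R, is_derive x 1 F (g x)) -> mean eps g = (F eps - F 0) / eps.
Proof.
move=> e0 FE; rewrite /mean; case: xgetP => [G _ /= GE|/(_ F)//].
congr (_ / _); apply: (is_derive_eq_diff (d := g) (a := 0) (b := eps)) => //; rewrite lexx ?ltW//.
Qed.

Lemma mean_le (R : realType) (eps : R) (g h : R -> R) : 0 < eps ->
  continuous g -> continuous h -> (forall r, 0 <= r <= eps -> g r <= h r) ->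
  mean eps g <= mean eps h.
Proof.
move=> e0 /antiderivative[G GE] /antiderivative[H HE] gh.
rewrite (mean_eq e0 GE) (mean_eq e0 HE).
rewrite ler_pM2r ?invr_gt0//.
by apply: (is_derive_le (df := g) (dg := h)) => //; exact: ltW.
Qed.

Lemma mean_lin (R : realType) (eps a : R) (g h : R -> R) : 0 < eps ->
  continuous g -> continuous h ->
  mean eps (fun r => a * g r + h r) = a * mean eps g + mean eps h.
Proof.
move=> e0 /antiderivative[G GE] /antiderivative[H HE].
rewrite (mean_eq e0 GE) (mean_eq e0 HE).
by rewrite (mean_eq (F := fun r => a * G r + H r))//; ring.
Qed.

Lemma mean_cst (R : realType) (eps c : R) : 0 < eps ->
  mean eps (fun=> c) = c.
Proof.
move=> e0; have E (x : R) : is_derive x 1 (fun r => c * r) c.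
  by rewrite -[X in is_derive _ _ _ X]mulr1; exact: is_deriveZ.
by rewrite (mean_eq e0 E) mulr0 subr0 mulfK// gt_eqF.
Qed.

(** A shifted antiderivative is an antiderivative of the shifted function. An average over a moving
    segment is therefore differentiable as soon as [g] is continuous: averaging gains one
    derivative. *)
Lemma is_derive_mean_shift (R : realType) (eps s : R) (g : R -> R) : 0 < eps ->
  continuous g ->
  is_derive s 1 (fun s => mean eps (fun r => g (r + s)))
    ((g (s + eps) - g s) / eps).
Proof.
move=> e0 /antiderivative[G GE].
have shiftE (t r : R) : is_derive r 1 (fun r => G (r + t)) (g (r + t)).
  rewrite -[g _]mulr1; apply: (is_derive1_comp (f := G)) => //.
  by apply: is_derive_shift.
rewrite (_ : (fun _ => _) = fun s => eps^-1 * (G (s + eps) - G s)).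
  rewrite mulrC; apply: is_deriveZ; exact: is_deriveB.
apply/funext => t; rewrite (mean_eq e0 (shiftE t)) add0r mulrC.
by rewrite (addrC eps).
Qed.

Lemma mvt_from0 (R : realType) (h dh : R -> R) (s : R) :
  (forall r : R, is_derive r 1 h (dh r)) ->
  exists2 c, `|c| <= `|s| & h s - h 0 = dh c * s.
Proof.
move=> hE.
have ch (a b : R) : {within `[a, b], continuous h}.
  by apply: continuous_subspaceT => x; exact: (is_derive_continuous (hE x)).
case: (leP 0 s) => [s0|/ltW s0].
  have [c] := MVT_segment s0 (fun r _ => hE r) (ch 0 s).
  rewrite in_itv/= => /andP[c0 cs] H; exists c; first by rewrite !ger0_norm.
  by rewrite H subr0.
have [c] := MVT_segment s0 (fun r _ => hE r) (ch s 0).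
rewrite in_itv/= => /andP[sc c0] H; exists c.
  by rewrite !ler0_norm// lerN2.
by rewrite -(opprB (h 0)) H sub0r mulrN opprK.
Qed.

Lemma taylor1 (R : realType) (h h1 : R -> R) (l s : R) : 0 <= l ->
  (forall r : R, is_derive r 1 h (h1 r)) ->
  (forall r, `|h1 r - h1 0| <= l * `|r|) ->
  `|h s - h 0 - s * h1 0| <= l * `|s| ^+ 2.
Proof.
move=> l0 hE h1l.
have E (r : R) : is_derive r 1 (fun r => h r - h1 0 * r) (h1 r - h1 0).
  apply: is_deriveB; rewrite -[X in is_derive _ _ _ X]mulr1; exact: is_deriveZ.
have [c cs] := mvt_from0 s E; rewrite mulr0 subr0 => H.
rewrite (_ : _ - _ - _ = (h1 c - h1 0) * s); last by rewrite -H; ring.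
rewrite normrM expr2 mulrA ler_wpM2r// (le_trans (h1l c))// ler_wpM2l//.
Qed.

Lemma taylor2 (R : realType) (h h1 h2 : R -> R) (l s : R) : 0 <= l ->
  (forall r : R, is_derive r 1 h (h1 r)) ->
  (forall r : R, is_derive r 1 h1 (h2 r)) ->
  (forall r, `|h2 r - h2 0| <= l * `|r|) ->
  `|h s - h 0 - s * h1 0 - s ^+ 2 / 2 * h2 0| <= l * `|s| ^+ 3.
Proof.
move=> l0 hE h1E h2l.
have E (r : R) : is_derive r 1 (fun r => h r - h1 0 * r - (h2 0 / 2) * r ^+ 2)
    (h1 r - h1 0 - r * h2 0).
  have -> : h1 r - h1 0 - r * h2 0 = h1 r - h1 0 * 1 - h2 0 / 2 * (r *+ 2 * 1).
    by rewrite -[r *+ 2]mulr_natl; field.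
  apply: is_deriveB.
    apply: is_deriveZ; apply: is_derive_eq; rewrite scaler1.
    by rewrite mulr1 mulr2n.
have [c cs] := mvt_from0 s E; rewrite expr0n !mulr0 !subr0 => H.
(* The derivative of the second-order remainder of [h] is the first-order remainder of [h1], to
   which [taylor1] applies at a point no farther from 0 than [s]. *)
rewrite (_ : _ - _ - _ - _ = (h1 c - h1 0 - c * h2 0) * s); last first.
  by rewrite -H; field.
rewrite normrM exprSr mulrA ler_wpM2r//.
rewrite (le_trans (taylor1 c l0 h1E h2l))// ler_wpM2l// lerXn2r// nnegrE//.
Qed.

(** * Lipschitz functions and averages along a direction *)

Definition lip (R : realType) (V : normedModType R) (L : R) (f : V -> R) :=
  forall x y, `|f x - f y| <= L * `|x - y|.

Lemma lip_continuous (R : realType) (V : normedModType R) (L : R) (f : V -> R) :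
  lip L f -> continuous f.
Proof.
move=> fL x; apply/cvgrPdist_lt => e e0; near=> y.
rewrite (le_lt_trans (fL x y))//.
have L0 : 0 < `|L| + 1 by rewrite ltr_wpDl.
rewrite (@le_lt_trans _ _ ((`|L| + 1) * `|x - y|))//.
  by rewrite ler_wpM2r// (le_trans (ler_norm _))// lerDl.
rewrite mulrC -ltr_pdivlMr//.
near: y; apply/nbhs_ballP; exists (e / (`|L| + 1)) => /=; first exact: divr_gt0.
by move=> y; rewrite -ball_normE.
Unshelve. all: by end_near. Qed.

Lemma lip_line (R : realType) (V : normedModType R) (L : R) (f : V -> R) (x e : V) :
  lip L f -> continuous (fun r : R => f (x + r *: e)).
Proof.
move=> fL; apply: (@lip_continuous _ R^o (L * `|e|)) => r s.
rewrite (le_trans (fL _ _))// opprD addrACA subrr add0r -scalerBl normrZ.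
by rewrite (mulrC `|_|) mulrA.
Qed.

Lemma lip_lin (R : realType) (V : normedModType R) (a L L' : R) (f g : V -> R) :
  lip L f -> lip L' g -> lip (`|a| * L + L') (fun x => a * f x + g x).
Proof.
move=> fL gL x y; rewrite opprD addrACA -mulrBr mulrDl.
by rewrite (le_trans (ler_normD _ _))// lerD// normrM -mulrA ler_wpM2l.
Qed.

Lemma lip_shift (R : realType) (V : normedModType R) (L : R) (f : V -> R) z :
  lip L f -> lip L (fun x => f (x + z)).
Proof. by move=> fL x y; rewrite (le_trans (fL _ _))// opprD addrACA subrr addr0. Qed.

Definition islip (R : realType) (V : normedModType R) (f : V -> R) :=
  exists L, lip L f.

Lemma islip_lin (R : realType) (V : normedModType R) (a : R) (f g : V -> R) :
  islip f -> islip g -> islip (fun x => a * f x + g x).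
Proof. by move=> [L fL] [L' gL]; exists (`|a| * L + L'); exact: lip_lin. Qed.

Lemma islip_cst (R : realType) (V : normedModType R) (a : R) :
  islip (fun _ : V => a).
Proof. by exists 0 => x y; rewrite subrr normr0 mul0r. Qed.

Lemma islip_scale (R : realType) (V : normedModType R) (a : R) (f : V -> R) :
  islip f -> islip (fun x => a * f x).
Proof.
move=> fl; have := islip_lin a fl (islip_cst V 0).
by rewrite (_ : (fun x => _ + 0) = fun x => a * f x)//; apply/funext => x; rewrite addr0.
Qed.

Lemma islip_add (R : realType) (V : normedModType R) (f g : V -> R) :
  islip f -> islip g -> islip (fun x => f x + g x).
Proof.
move=> fl gl; have := islip_lin 1 fl gl.
by rewrite (_ : (fun x => 1 * _ + _) = fun x => f x + g x)//; apply/funext => x; rewrite mul1r.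
Qed.

Definition box (R : realType) (V : normedModType R) (eps : R) (e : V)
    (f : V -> R) : V -> R :=
  fun x => mean eps (fun r => f (x + r *: e)).

Definition dquot (R : realType) (V : normedModType R) (eps : R) (e : V)
    (f : V -> R) : V -> R :=
  fun x => (f (x + eps *: e) - f x) / eps.

(** Linearity is restricted to Lipschitz functions: when there is no antiderivative along the line,
    [mean] returns a default value and need not be linear. *)
Definition linop (R : realType) (V : normedModType R)
    (T : (V -> R) -> (V -> R)) :=
  (forall f, islip f -> islip (T f)) /\
  (forall a f g, islip f -> islip g ->
     T (fun x => a * f x + g x) = fun x => a * T f x + T g x).

Lemma linop_comp (R : realType) (V : normedModType R)
    (T S : (V -> R) -> (V -> R)) : linop T -> linop S -> linop (T \o S).
Proof.
move=> [T1 T2] [S1 S2]; split => [f /S1/T1//|a f g fl gl /=].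
by rewrite S2// T2//; exact: S1.
Qed.

Lemma linop0 (R : realType) (V : normedModType R) (T : (V -> R) -> (V -> R)) :
  linop T -> T (fun=> 0) = fun=> 0.
Proof.
move=> [_ T2]; have := T2 (- 1) _ _ (islip_cst V 0) (islip_cst V 0).
rewrite (_ : (fun=> _) = (fun=> 0)); last by apply/funext => x; rewrite mulr0 addr0.
by move=> ->; apply/funext => x; rewrite mulN1r addrC subrr.
Qed.

Lemma linopZ (R : realType) (V : normedModType R) (T : (V -> R) -> (V -> R)) a f :
  linop T -> islip f -> T (fun x => a * f x) = fun x => a * T f x.
Proof.
move=> TL fl; have := TL.2 a _ _ fl (islip_cst V 0).
rewrite (linop0 TL) (_ : (fun x => _ + 0) = fun x => a * f x); last first.
  by apply/funext => x; rewrite addr0.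
by move=> ->; apply/funext => x; rewrite addr0.
Qed.

Lemma linopD (R : realType) (V : normedModType R) (T : (V -> R) -> (V -> R)) f g :
  linop T -> islip f -> islip g ->
  T (fun x => f x + g x) = fun x => T f x + T g x.
Proof.
move=> TL fl gl; have := TL.2 1 _ _ fl gl.
rewrite (_ : (fun x => 1 * _ + _) = fun x => f x + g x); last first.
  by apply/funext => x; rewrite mul1r.
by move=> ->; apply/funext => x; rewrite mul1r.
Qed.

Lemma linopB (R : realType) (V : normedModType R) (T : (V -> R) -> (V -> R)) f g :
  linop T -> islip f -> islip g ->
  T (fun x => f x - g x) = fun x => T f x - T g x.
Proof.
move=> TL fl gl; have := TL.2 (-1) _ _ gl fl.
rewrite (_ : (fun x => - 1 * _ + _) = fun x => f x - g x); last first.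
  by apply/funext => x; rewrite mulN1r addrC.
by move=> ->; apply/funext => x; rewrite mulN1r addrC.
Qed.

Lemma linop_sum (R : realType) (V : normedModType R) (T : (V -> R) -> (V -> R))
    (I : Type) (s : seq I) (c : I -> R) (f : I -> V -> R) :
  linop T -> (forall i, islip (f i)) ->
  islip (fun x => \sum_(i <- s) c i * f i x) /\
  T (fun x => \sum_(i <- s) c i * f i x) = fun x => \sum_(i <- s) c i * T (f i) x.
Proof.
move=> TL fl; elim: s => [|i s [IH1 IH2]].
  rewrite (_ : (fun x => _) = fun=> 0); last by apply/funext => x; rewrite big_nil.
  split; first exact: islip_cst.
  by rewrite linop0//; apply/funext => x; rewrite big_nil.
rewrite (_ : (fun x => _) = fun x => c i * f i x + \sum_(j <- s) c j * f j x); last first.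
  by apply/funext => x; rewrite big_cons.
split; first exact: islip_lin.
by rewrite TL.2// IH2; apply/funext => x; rewrite big_cons.
Qed.

Lemma dquot_lip (R : realType) (V : normedModType R) (eps L : R) (e : V) f :
  0 < eps -> lip L f -> lip (2 * L / eps) (dquot eps e f).
Proof.
move=> e0 fL x y; rewrite /dquot -mulrBl normrM [`|eps^-1|]gtr0_norm ?invr_gt0//.
rewrite mulrAC ler_pM2r ?invr_gt0//.
rewrite (_ : _ - _ = (f (x + eps *: e) - f (y + eps *: e)) - (f x - f y)); last by ring.
rewrite (le_trans (ler_normB _ _))// -mulrA mulr_natl mulr2n lerD//.
exact: (lip_shift (eps *: e) fL x y).
Qed.

Lemma box_le (R : realType) (V : normedModType R) (eps : R) (e : V) f g :
  0 < eps -> islip f -> islip g -> (forall x, f x <= g x) ->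
  forall x, box eps e f x <= box eps e g x.
Proof.
move=> e0 [L fL] [L' gL] fg x; apply: mean_le => //; exact: lip_line.
Qed.

Lemma box_lip (R : realType) (V : normedModType R) (eps L : R) (e : V) f :
  0 < eps -> lip L f -> lip L (box eps e f).
Proof.
move=> e0 fL x y.
have lc z : continuous (fun r : R => f (z + r *: e)) by exact: lip_line fL.
have cc (c : R) : continuous (fun _ : R => c) by move=> ?; exact: cst_continuous.
have H (a b : V) : box eps e f a - box eps e f b <= L * `|a - b|.
  rewrite lerBlDl -[leRHS](_ : mean eps (fun r => 1 * f (b + r *: e) + L * `|a - b|) = _).
    apply: mean_le => //; first by move=> ?; apply: cvgD; [apply: cvgM; [exact: cst_continuous|exact: lc]|exact: cst_continuous].
    move=> r _; rewrite mul1r -lerBlDl (le_trans (ler_norm _))//.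
    by rewrite (le_trans (fL _ _))// opprD addrACA subrr addr0.
  by rewrite mean_lin// mean_cst// mul1r.
by rewrite ler_norml lerNl opprB !H distrC H.
Qed.

Lemma box_linop (R : realType) (V : normedModType R) (eps : R) (e : V) :
  0 < eps -> linop (box eps e).
Proof.
move=> e0; split=> [f [L fL]|a f g [L fL] [L' gL]].
  by exists L; exact: box_lip.
by apply/funext => x; rewrite /box mean_lin//; exact: lip_line.
Qed.

Lemma dquot_linop (R : realType) (V : normedModType R) (eps : R) (e : V) :
  0 < eps -> linop (dquot eps e).
Proof.
move=> e0; split=> [f [L fL]|a f g _ _].
  by exists (2 * L / eps); exact: dquot_lip.
by apply/funext => x; rewrite /dquot; field; rewrite gt_eqF.
Qed.

Lemma box_cst (R : realType) (V : normedModType R) (eps c : R) (e : V) :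
  0 < eps -> box eps e (fun=> c) = fun=> c.
Proof. by move=> e0; apply/funext => x; rewrite /box mean_cst. Qed.

Lemma box_shift (R : realType) (V : normedModType R) (eps : R) (e z : V) f :
  box eps e (fun x => f (x + z)) = fun x => box eps e f (x + z).
Proof.
by apply/funext => x; congr mean; apply/funext => r; rewrite addrAC.
Qed.

Lemma dquot_shift (R : realType) (V : normedModType R) (eps : R) (e z : V) f :
  dquot eps e (fun x => f (x + z)) = fun x => dquot eps e f (x + z).
Proof. by apply/funext => x; rewrite /dquot addrAC. Qed.

(** [is_derive_box] differentiates functions of the form [box f]. Moving [box] to the outside brings
    [dmol] into this form, and this makes [ddmol] a second derivative. *)
Lemma box_dquot (R : realType) (V : normedModType R) (eps : R) (e : V) f :
  0 < eps -> islip f -> box eps e (dquot eps e f) = dquot eps e (box eps e f).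
Proof.
move=> e0 fl; have fs : islip (fun x => f (x + eps *: e)).
  by case: fl => L /(lip_shift (eps *: e)) ?; exists L.
have bl := box_linop e e0.
have -> : dquot eps e f = fun x => eps^-1 * (f (x + eps *: e) - f x).
  by apply/funext => x; rewrite mulrC.
have -> : dquot eps e (box eps e f) =
    fun x => eps^-1 * (box eps e f (x + eps *: e) - box eps e f x).
  by apply/funext => x; rewrite mulrC.
rewrite linopZ//; last first.
  have := islip_lin (-1) fl fs; rewrite (_ : (fun x => -1 * _ + _) = fun x => f (x + eps *: e) - f x)//.
  by apply/funext => x; rewrite mulN1r addrC.
by rewrite linopB// box_shift.
Qed.

Lemma box_close (R : realType) (V : normedModType R) (eps L : R) (e : V) f x :
  0 < eps -> `|e| <= 1 -> 0 <= L -> lip L f -> `|box eps e f x - f x| <= L * eps.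
Proof.
move=> e0 e1 L0 fL.
have H r : 0 <= r <= eps -> `|f (x + r *: e) - f x| <= L * eps.
  move=> /andP[r0 re]; rewrite (le_trans (fL _ _))// ler_wpM2l//.
  by rewrite addrAC subrr add0r normrZ ger0_norm// (le_trans _ re)// ler_piMr.
have lc : continuous (fun r : R => f (x + r *: e)) by exact: lip_line fL.
have cc (c : R) : continuous (fun _ : R => c) by move=> ?; exact: cst_continuous.
rewrite ler_distl; apply/andP; split.
  rewrite -[leLHS](@mean_cst _ eps)//; apply: mean_le => // r /H.
  by rewrite ler_distl => /andP[].
rewrite -[leRHS](@mean_cst _ eps)//; apply: mean_le => // r /H.
by rewrite ler_distl => /andP[].
Qed.

Lemma is_derive_box (R : realType) (V : normedModType R) (eps s : R) (e x : V) f :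
  0 < eps -> islip f ->
  is_derive s 1 (fun s => box eps e f (x + s *: e)) (dquot eps e f (x + s *: e)).
Proof.
move=> e0 [L fL].
have := is_derive_mean_shift s e0 (lip_line (x := x) (e := e) fL).
rewrite /dquot scalerDl addrA.
by under eq_fun do under eq_fun do rewrite scalerDl addrA addrAC.
Qed.

Lemma box_bound (R : realType) (V : normedModType R) (eps K : R) (e : V) f :
  0 < eps -> islip f -> (forall x, `|f x| <= K) ->
  forall x, `|box eps e f x| <= K.
Proof.
move=> e0 fl fK x; rewrite ler_norml; apply/andP; split.
  rewrite -[leLHS](_ : box eps e (fun=> - K) x = _); last by rewrite box_cst.
  apply: box_le => //; first exact: islip_cst.
  by move=> z; have := fK z; rewrite ler_norml => /andP[].
rewrite -[leRHS](_ : box eps e (fun=> K) x = _); last by rewrite box_cst.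
apply: box_le => //; first exact: islip_cst.
by move=> z; have := fK z; rewrite ler_norml => /andP[].
Qed.

Lemma dquot_bound (R : realType) (V : normedModType R) (eps K : R) (e : V) f :
  0 < eps -> (forall x, `|f x| <= K) ->
  forall x, `|dquot eps e f x| <= 2 / eps * K.
Proof.
move=> e0 fK x; rewrite /dquot normrM [`|eps^-1|]gtr0_norm ?invr_gt0//.
rewrite mulrAC ler_pM2r ?invr_gt0// (le_trans (ler_normB _ _))//.
by rewrite mulr_natl mulr2n lerD.
Qed.

(* For Lipschitz [f], [dmol eps e f] and [ddmol eps e f] are the first two
   derivatives of [cmol eps e f] in the direction [e]. *)
Definition cmol (R : realType) (V : normedModType R) (eps : R) (e : V) :=
  box eps e \o box eps e.

Definition dmol (R : realType) (V : normedModType R) (eps : R) (e : V) :=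
  dquot eps e \o box eps e.

Definition ddmol (R : realType) (V : normedModType R) (eps : R) (e : V) :=
  dquot eps e \o dquot eps e.

Lemma cmol_linop (R : realType) (V : normedModType R) (eps : R) (e : V) :
  0 < eps -> linop (cmol eps e).
Proof. by move=> e0; apply: linop_comp; exact: box_linop. Qed.

Lemma dmol_linop (R : realType) (V : normedModType R) (eps : R) (e : V) :
  0 < eps -> linop (dmol eps e).
Proof. by move=> e0; apply: linop_comp; [exact: dquot_linop|exact: box_linop]. Qed.

Lemma ddmol_linop (R : realType) (V : normedModType R) (eps : R) (e : V) :
  0 < eps -> linop (ddmol eps e).
Proof. by move=> e0; apply: linop_comp; exact: dquot_linop. Qed.

Lemma cmol_lip (R : realType) (V : normedModType R) (eps L : R) (e : V) f :
  0 < eps -> lip L f -> lip L (cmol eps e f).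
Proof. by move=> e0 fL; do 2 apply: box_lip => //. Qed.

Lemma dmol_lip (R : realType) (V : normedModType R) (eps L : R) (e : V) f :
  0 < eps -> lip L f -> lip (2 * L / eps) (dmol eps e f).
Proof. by move=> e0 fL; apply: dquot_lip => //; exact: box_lip. Qed.

Lemma ddmol_lip (R : realType) (V : normedModType R) (eps L : R) (e : V) f :
  0 < eps -> lip L f -> lip (4 * L / eps ^+ 2) (ddmol eps e f).
Proof.
move=> e0 fL; rewrite (_ : 4 * _ / _ = 2 * (2 * L / eps) / eps).
  by do 2 apply: dquot_lip => //.
by field; rewrite gt_eqF.
Qed.

Lemma cmol_bound (R : realType) (V : normedModType R) (eps K : R) (e : V) f :
  0 < eps -> islip f -> (forall x, `|f x| <= K) ->
  forall x, `|cmol eps e f x| <= K.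
Proof.
move=> e0 fl fK x; apply: box_bound => //; first exact: (box_linop _ _).1.
exact: box_bound.
Qed.

Lemma dmol_bound (R : realType) (V : normedModType R) (eps K : R) (e : V) f :
  0 < eps -> islip f -> (forall x, `|f x| <= K) ->
  forall x, `|dmol eps e f x| <= 2 / eps * K.
Proof. by move=> e0 fl fK x; apply: dquot_bound => //; exact: box_bound. Qed.

Lemma cmol_shift (R : realType) (V : normedModType R) (eps : R) (e z : V) f :
  cmol eps e (fun x => f (x + z)) = fun x => cmol eps e f (x + z).
Proof. by rewrite /cmol /= !box_shift. Qed.

Lemma dmol_shift (R : realType) (V : normedModType R) (eps : R) (e z : V) f :
  dmol eps e (fun x => f (x + z)) = fun x => dmol eps e f (x + z).
Proof. by rewrite /dmol /= box_shift dquot_shift. Qed.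

Lemma cmol_taylor1 (R : realType) (V : normedModType R) (eps L s : R) (e x : V) f :
  0 < eps -> `|e| <= 1 -> 0 <= L -> lip L f ->
  `|cmol eps e f (x + s *: e) - cmol eps e f x - s * dmol eps e f x|
    <= 2 * L / eps * `|s| ^+ 2.
Proof.
move=> e0 e1 L0 fL.
have bl : islip (box eps e f) by exists L; exact: box_lip.
have := @taylor1 R (fun s => cmol eps e f (x + s *: e))
  (fun s => dmol eps e f (x + s *: e)) (2 * L / eps) s.
rewrite /= scale0r addr0; apply.
- by rewrite divr_ge0 ?mulr_ge0// ltW.
- by move=> r; exact: is_derive_box.
- move=> r; rewrite (le_trans (dmol_lip e e0 fL _ _))// addrAC subrr add0r.
  by rewrite normrZ ler_wpM2l ?ler_piMr// divr_ge0 ?mulr_ge0// ltW.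
Qed.

Lemma cmol_taylor2 (R : realType) (V : normedModType R) (eps L s : R) (e x : V) f :
  0 < eps -> `|e| <= 1 -> 0 <= L -> lip L f ->
  `|cmol eps e f (x + s *: e) - cmol eps e f x - s * dmol eps e f x
    - s ^+ 2 / 2 * ddmol eps e f x| <= 4 * L / eps ^+ 2 * `|s| ^+ 3.
Proof.
move=> e0 e1 L0 fL.
have fl : islip f by exists L.
have := @taylor2 R (fun s => cmol eps e f (x + s *: e))
  (fun s => dmol eps e f (x + s *: e)) (fun s => ddmol eps e f (x + s *: e))
  (4 * L / eps ^+ 2) s.
rewrite /= scale0r addr0; apply.
- by apply: divr_ge0; [exact: mulr_ge0|rewrite ?sqr_ge0// ltW].
- by move=> r; apply: is_derive_box => //; exists L; exact: box_lip.
- move=> r; rewrite /dmol /= -box_dquot//; apply: is_derive_box => //.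
  exact: (dquot_linop _ _).1.
- move=> r; rewrite (le_trans (ddmol_lip e e0 fL _ _))// addrAC subrr add0r.
  by rewrite normrZ ler_wpM2l ?ler_piMr//; apply: divr_ge0; [exact: mulr_ge0|rewrite ?sqr_ge0// ltW].
Qed.

(** Averaging twice in each direction makes the second derivative in that direction Lipschitz, with
    a constant of order [eps^-2], as in [ddmol_lip]. *)
Definition mol (R : realType) (V : normedModType R) (I : Type) (eps : R)
    (es : I -> V) (l : seq I) (f : V -> R) : V -> R :=
  foldr (fun i => cmol eps (es i)) f l.

Lemma mol_linop (R : realType) (V : normedModType R) (I : Type) (eps : R)
  (es : I -> V) (l : seq I) : 0 < eps -> linop (mol eps es l).
Proof.
move=> e0; elim: l => [|i l IH]; first by [].
by apply: (linop_comp (T := cmol eps (es i))) => //; exact: cmol_linop.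
Qed.

Lemma mol_lip (R : realType) (V : normedModType R) (I : Type) (eps L : R)
    (es : I -> V) (l : seq I) f :
  0 < eps -> lip L f -> lip L (mol eps es l f).
Proof. by move=> e0 fL; elim: l => //= i l; exact: cmol_lip. Qed.

Lemma mol_le (R : realType) (V : normedModType R) (I : Type) (eps : R)
    (es : I -> V) (l : seq I) f g : 0 < eps -> islip f -> islip g ->
  (forall x, f x <= g x) -> forall x, mol eps es l f x <= mol eps es l g x.
Proof.
move=> e0 fl gl fg; elim: l => //= i l IH.
have ml h : islip h -> islip (mol eps es l h) by exact: (mol_linop _ _ _).1.
have bl h : islip h -> islip (box eps (es i) h) by exact: (box_linop _ _).1.
by move=> x; do 2 (apply: box_le; [by []|by auto|by auto|]).
Qed.

Lemma mol_cst (R : realType) (V : normedModType R) (I : Type) (eps c : R)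
  (es : I -> V) (l : seq I) : 0 < eps -> mol eps es l (fun=> c) = fun=> c.
Proof. by move=> e0; elim: l => //= i l ->; rewrite /cmol /= !box_cst. Qed.

Lemma mol_shift (R : realType) (V : normedModType R) (I : Type) (eps : R)
    (es : I -> V) (l : seq I) (z : V) f :
  mol eps es l (fun x => f (x + z)) = fun x => mol eps es l f (x + z).
Proof. by elim: l => //= i l ->; rewrite cmol_shift. Qed.

Lemma mol_close (R : realType) (V : normedModType R) (I : Type) (eps L : R)
    (es : I -> V) (l : seq I) f :
  0 < eps -> (forall i, `|es i| <= 1) -> 0 <= L -> lip L f ->
  forall x, `|mol eps es l f x - f x| <= (size l)%:R * (2 * L * eps).
Proof.
move=> e0 e1 L0 fL x; elim: l => [|i l IH]; first by rewrite subrr normr0 mul0r.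
have ml : lip L (mol eps es l f) by exact: mol_lip.
have bl : lip L (box eps (es i) (mol eps es l f)) by exact: box_lip.
rewrite /= /cmol /=.
have H1 := box_close x e0 (e1 i) L0 bl.
have H2 := box_close x e0 (e1 i) L0 ml.
have D1 := ler_distD (box eps (es i) (mol eps es l f) x)
  (box eps (es i) (box eps (es i) (mol eps es l f)) x) (f x).
have D2 := ler_distD (mol eps es l f x) (box eps (es i) (mol eps es l f) x) (f x).
rewrite -natr1; lra.
Qed.

(* Averaging preserves Taylor inequalities, so the directions can be treated one
   at a time, without exchanging the order of two averages. *)
Lemma mol_taylor (R : realType) (V : normedModType R) (I : finType) (eps L : R)
    (es : I -> V) (l : seq I) (f : V -> R) :
  0 < eps -> (forall i, `|es i| <= 1) -> 0 <= L -> lip L f ->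
  exists (p : I -> V -> R) (X : I * I -> V -> R),
  [/\ forall i, islip (p i), forall k, islip (X k)
    & forall (x : V) (y : I -> R) (rho : R), 0 <= rho -> (forall i, `|y i| <= rho) ->
      let d := \sum_(i <- l) y i *: es i in
      let n := (size l)%:R in
      let w := mol eps es l f in
      let t1 := w (x + d) - w x - \sum_i y i * p i x in
      `|t1| <= (n ^+ 2 + n) * L / eps * rho ^+ 2 /\
      `|t1 - \sum_k (y k.1 * y k.2) * X k x|
        <= 4 * (n + 1) ^+ 3 * L / eps ^+ 2 * rho ^+ 3].
Proof.
move=> e0 e1 L0 fL.
elim: l => [|k l [p [X [pl Xl H]]]].
  exists (fun _ _ => 0), (fun _ _ => 0); split=> [i|i|x y rho r0 yr].
  - exact: islip_cst.
  - exact: islip_cst.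
  - rewrite /= big_nil addr0 subrr.
    rewrite !big1 => [| |]; try by move=> *; rewrite mulr0.
    rewrite !subrr normr0; split.
      by rewrite expr0n/= addr0 !mul0r.
    by rewrite !mulr_ge0// ?invr_ge0 exprn_ge0// ltW.
pose w := mol eps es l f; pose e := es k.
have wL : lip L w by exact: mol_lip.
have wl : islip w by exists L.
have Cl : linop (cmol eps e) by exact: cmol_linop.
have Gl : linop (dmol eps e) by exact: dmol_linop.
have Hl : linop (ddmol eps e) by exact: ddmol_linop.
(* The step along [e] is expanded at [x + d], and its coefficients are then moved back to [x]: to
   first order [dmol w (x + d)] is [dmol w x + dmol P x], which produces the mixed terms of [X'].
   They all stand in row [k], so [X'] is not symmetric. *)
pose p' i x := cmol eps e (p i) x + (i == k)%:R * dmol eps e w x.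
pose X' (q : I * I) x := cmol eps e (X q) x +
  ((q.1 == k)%:R * dmol eps e (p q.2) x +
   (q.1 == k)%:R * (q.2 == k)%:R / 2 * ddmol eps e w x).
exists p', X'; split=> [i|q|x y rho r0 yr].
- by apply: islip_add; [exact: Cl.1|exact/islip_scale/Gl.1].
- apply: islip_add; first exact: Cl.1.
  by apply: islip_add; apply: islip_scale; [exact: Gl.1|exact: Hl.1].
move=> d0 n' w' t1; rewrite {}/t1.
pose d := \sum_(i <- l) y i *: es i.
pose P x := \sum_i y i * p i x.
pose Q x := \sum_q (y q.1 * y q.2) * X q x.
have Pl T : linop T -> islip P /\ T P = fun x => \sum_i y i * T (p i) x.
  by move=> TL; exact: linop_sum.
have Ql T : linop T -> islip Q /\ T Q = fun x => \sum_q (y q.1 * y q.2) * T (X q) x.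
  by move=> TL; exact: linop_sum.
have d0E : x + d0 = x + d + y k *: e by rewrite /d0 big_cons -addrA (addrC d).
have p'E : \sum_i y i * p' i x = cmol eps e P x + y k * dmol eps e w x.
  rewrite (Pl _ Cl).2 -[X in _ = _ + y k * X]mul1r -(eqxx k).
  under eq_bigr do rewrite mulrDr.
  rewrite big_split/=; congr (_ + _).
  rewrite (bigD1 k)//= big1 ?addr0 ?eqxx// => i /negbTE ->.
  by rewrite mul0r mulr0.
have X'E : \sum_q (y q.1 * y q.2) * X' q x =
    cmol eps e Q x + y k * dmol eps e P x + y k ^+ 2 / 2 * ddmol eps e w x.
  rewrite (Ql _ Cl).2 (Pl _ Gl).2.
  under eq_bigr do rewrite mulrDr.
  rewrite big_split/= -addrA; congr (_ + _).
  rewrite -(pair_bigA _ (fun i j => y i * y j * ((i == k)%:R * dmol eps e (p j) x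
      + (i == k)%:R * (j == k)%:R / 2 * ddmol eps e w x)))/=.
  rewrite (bigD1 k)//= [X in _ + X]big1 ?addr0; last first.
    by move=> i /negbTE ->; rewrite big1// => j _; rewrite !mul0r addr0 mulr0.
  under eq_bigr do rewrite eqxx !mul1r mulrDr.
  rewrite big_split/= mulr_sumr; congr (_ + _).
    by apply: eq_bigr => j _; rewrite mulrA.
  rewrite (bigD1 k)//= [X in _ + X]big1 ?addr0; last first.
    by move=> i /negbTE ->; rewrite !mul0r mulr0.
  by rewrite eqxx mul1r expr2; field.
have dn : `|d| <= (size l)%:R * rho.
  rewrite /d; elim: (l) => [|i s IH]; first by rewrite big_nil normr0 mul0r.
  rewrite big_cons /= -natr1 mulrDl mul1r addrC (le_trans (ler_normD _ _))// lerD//.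
  by rewrite normrZ (le_trans _ (yr i))// ler_piMr.
pose nl : R := (size l)%:R.
have H1 z : `|w (z + d) - w z - P z| <= (nl ^+ 2 + nl) * L / eps * rho ^+ 2.
  by case: (H z y rho r0 yr).
have H2 z : `|w (z + d) - w z - P z - Q z| <= 4 * (nl + 1) ^+ 3 * L / eps ^+ 2 * rho ^+ 3.
  by case: (H z y rho r0 yr).
have n0 : 0 <= nl by [].
rewrite d0E p'E X'E /w' /= -/w -/e.
have -> : n' = nl + 1 by rewrite /n' /= -natr1.
have yk := yr k.
have ul : islip (fun z => w (z + d) - w z - P z).
  rewrite (_ : (fun z => _) = fun z => (-1) * P z + ((-1) * w z + w (z + d))).
    apply: islip_lin; first exact: (Pl _ Cl).1.
    by apply: islip_lin => //; exists L; exact: lip_shift.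
  by apply/funext => z; ring.
have wdl : islip (fun z => w (z + d)) by exists L; exact: lip_shift.
have Pi : islip P := (Pl _ Cl).1.
have Qi : islip Q := (Ql _ Cl).1.
have wB T : linop T -> islip (fun z => w (z + d) - w z).
  move=> TL; have := islip_lin (-1) wl wdl.
  by rewrite (_ : (fun z => _ + _) = fun z => w (z + d) - w z)//; apply/funext => z; ring.
have linu T : linop T -> (forall z g, T (fun x => g (x + z)) = fun x => T g (x + z)) ->
    T (fun z => w (z + d) - w z - P z) = fun z => T w (z + d) - T w z - T P z.
  move=> TL Ts; rewrite (@linopB _ _ _ (fun z => w (z + d) - w z))//; last exact: wB TL.
  by rewrite (@linopB _ _ _ (fun z => w (z + d)))// Ts.
(* Applying [cmol] to the inequalities [H1] and [H2] keeps their bounds; applying [dmol] costs a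
   factor [2 / eps]. *)
have T2 : `|cmol eps e w (x + d) - cmol eps e w x - cmol eps e P x|
    <= (nl ^+ 2 + nl) * L / eps * rho ^+ 2.
  have := cmol_bound e e0 ul H1 x.
  by rewrite linu// => *; exact: cmol_shift.
have T4 : `|dmol eps e w (x + d) - dmol eps e w x - dmol eps e P x|
    <= 2 / eps * ((nl ^+ 2 + nl) * L / eps * rho ^+ 2).
  have := dmol_bound e e0 ul H1 x.
  by rewrite linu// => *; exact: dmol_shift.
have T6 : `|cmol eps e w (x + d) - cmol eps e w x - cmol eps e P x - cmol eps e Q x|
    <= 4 * (nl + 1) ^+ 3 * L / eps ^+ 2 * rho ^+ 3.
  have uQ : islip (fun z => w (z + d) - w z - P z - Q z).
    have := islip_lin (-1) Qi ul.
    by rewrite (_ : (fun z => _ + _) = fun z => w (z + d) - w z - P z - Q z)//; apply/funext => z; ring.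
  have := cmol_bound e e0 uQ H2 x.
  rewrite (@linopB _ _ _ (fun z => w (z + d) - w z - P z))//.
  by rewrite linu// => *; exact: cmol_shift.
have yk2 : `|y k| ^+ 2 <= rho ^+ 2 by rewrite lerXn2r// nnegrE.
have yk3 : `|y k| ^+ 3 <= rho ^+ 3 by rewrite lerXn2r// nnegrE.
have L1 : 0 <= L / eps by rewrite divr_ge0// ltW.
have L2 : 0 <= L / eps ^+ 2 by rewrite divr_ge0// sqr_ge0.
have dx : x + d - x = d by rewrite addrAC subrr add0r.
have T1 : `|cmol eps e w (x + d + y k *: e) - cmol eps e w (x + d) -
    y k * dmol eps e w (x + d)| <= 2 * (L / eps) * rho ^+ 2.
  rewrite (le_trans (cmol_taylor1 _ _ e0 (e1 k) L0 wL))// -!mulrA.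
  by rewrite !ler_wpM2l// invr_ge0 ltW.
have T1' : `|cmol eps e w (x + d + y k *: e) - cmol eps e w (x + d) -
    y k * dmol eps e w (x + d) - y k ^+ 2 / 2 * ddmol eps e w (x + d)|
    <= 4 * (L / eps ^+ 2) * rho ^+ 3.
  rewrite (le_trans (cmol_taylor2 _ _ e0 (e1 k) L0 wL))// -!mulrA.
  by rewrite !ler_wpM2l// invr_ge0 sqr_ge0.
have T3 : `|y k * (dmol eps e w (x + d) - dmol eps e w x)| <=
    rho * (2 * (L / eps) * (nl * rho)).
  rewrite normrM ler_pM// (le_trans (dmol_lip e e0 wL _ _))// dx -!mulrA.
  by rewrite !ler_wpM2l// ?invr_ge0 ?ltW// mulrC.
have T4' : `|y k * (dmol eps e w (x + d) - dmol eps e w x - dmol eps e P x)| <=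
    rho * (2 / eps * ((nl ^+ 2 + nl) * L / eps * rho ^+ 2)).
  by rewrite normrM ler_pM.
have T5 : `|y k ^+ 2 / 2 * (ddmol eps e w (x + d) - ddmol eps e w x)| <=
    rho ^+ 2 / 2 * (4 * (L / eps ^+ 2) * (nl * rho)).
  rewrite normrM normrM normrX [`|2^-1|]gtr0_norm ?invr_gt0//.
  rewrite ler_pM ?mulr_ge0 ?exprn_ge0 ?invr_ge0// ?ler_wpM2r ?invr_ge0//.
  rewrite (le_trans (ddmol_lip e e0 wL _ _))// dx -!mulrA.
  by rewrite !ler_wpM2l// invr_ge0 sqr_ge0.
split.
  rewrite [X in `|X|](_ : _ =
    (cmol eps e w (x + d + y k *: e) - cmol eps e w (x + d) - y k * dmol eps e w (x + d))
    + (cmol eps e w (x + d) - cmol eps e w x - cmol eps e P x)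
    + (y k * (dmol eps e w (x + d) - dmol eps e w x))); last by ring.
  apply: (@le_trans _ _ (2 * (L / eps) * rho ^+ 2 +
    (nl ^+ 2 + nl) * L / eps * rho ^+ 2 + rho * (2 * (L / eps) * (nl * rho)))).
    apply: le_trans (ler_normD _ _) _; apply: lerD => //.
    by apply: le_trans (ler_normD _ _) _; exact: lerD.
  by rewrite le_eqVlt; apply/orP; left; apply/eqP; field; rewrite gt_eqF.
(* Telescoping: the expansion along [e] at [x + d], the averaged expansion along [d], and the errors
   of moving the first and the second derivative from [x + d] to [x]. *)
rewrite [X in `|X|](_ : _ =
    (cmol eps e w (x + d + y k *: e) - cmol eps e w (x + d) - y k * dmol eps e w (x + d)
       - y k ^+ 2 / 2 * ddmol eps e w (x + d))
    + (cmol eps e w (x + d) - cmol eps e w x - cmol eps e P x - cmol eps e Q x)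
    + (y k * (dmol eps e w (x + d) - dmol eps e w x - dmol eps e P x))
    + (y k ^+ 2 / 2 * (ddmol eps e w (x + d) - ddmol eps e w x))); last by ring.
apply: (@le_trans _ _ (4 * (L / eps ^+ 2) * rho ^+ 3 +
    4 * (nl + 1) ^+ 3 * L / eps ^+ 2 * rho ^+ 3 +
    rho * (2 / eps * ((nl ^+ 2 + nl) * L / eps * rho ^+ 2)) +
    rho ^+ 2 / 2 * (4 * (L / eps ^+ 2) * (nl * rho)))).
  apply: le_trans (ler_normD _ _) _; apply: lerD => //.
  apply: le_trans (ler_normD _ _) _; apply: lerD => //.
  by apply: le_trans (ler_normD _ _) _; exact: lerD.
(* Passing from [4 (nl + 1)^3] to [4 (nl + 2)^3] leaves more room than the other three terms
   require; the surplus is this polynomial. *)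
rewrite -subr_ge0 [leRHS](_ : _ = (10 * nl ^+ 2 + 32 * nl + 24) * (L / eps ^+ 2 * rho ^+ 3)).
  apply: mulr_ge0; last by rewrite mulr_ge0// exprn_ge0.
  by rewrite !addr_ge0// mulr_ge0// sqr_ge0.
by field; rewrite gt_eqF.
Qed.

(** * Random walks and value iteration *)

Lemma norm_coord (R : realType) (m n : nat) (x : 'M[R]_(m, n)) i j :
  `|x i j| <= `|x|.
Proof.
rewrite [leRHS]/Num.norm/= mx_normrE; apply/bigmax_geP; right.
by exists (i, j).
Qed.

Lemma norm_rV_le (R : realType) (N : nat) (x : 'rV[R]_N) (r : R) :
  0 <= r -> (forall i, `|x 0 i| <= r) -> `|x| <= r.
Proof.
move=> r0 xr; rewrite [leLHS]/Num.norm/= mx_normrE; apply/bigmax_leP.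
by split => // -[i j] _ /=; rewrite (ord1 i).
Qed.

Definition quad (R : realType) (N : nat) (p : 'rV[R]_N) (X : 'M[R]_N)
    (y : 'rV[R]_N) : R :=
  \sum_i p 0 i * y 0 i + (\sum_i \sum_j X i j * (y 0 i * y 0 j)) / 2.

(** Polynomial substitute for the cubic Taylor remainder, at the parabolic scale [|y| ~ sqrt h]. Its
    value at 0 is only [h^2], and for [h > 0] it is positive, so that its growth can be measured
    relative to itself. *)
Definition quartic (R : realType) (N : nat) (h : R) (y : 'rV[R]_N) : R :=
  \sum_i y 0 i ^+ 4 + h ^+ 2.

Lemma quad0 (R : realType) (N : nat) (p : 'rV[R]_N) (X : 'M[R]_N) :
  quad p X 0 = 0.
Proof.
rewrite /quad !big1 ?mul0r ?addr0// => i _; last by rewrite mxE mulr0.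
by rewrite big1// => j _; rewrite !mxE !mulr0.
Qed.

(** First-order and mixed terms cancel, so a symmetric random step acts on quadratic polynomials
    without error. *)
Lemma quad_parallelogram (R : realType) (N : nat) (p : 'rV[R]_N) (X : 'M[R]_N) y z :
  quad p X (y + z) + quad p X (y - z) =
  2 * quad p X y + \sum_i \sum_j X i j * (z 0 i * z 0 j).
Proof.
rewrite /quad addrACA -mulrDl -!big_split/= mulrDr -addrA; congr (_ + _).
  by rewrite mulr_sumr; apply: eq_bigr => i _; rewrite !mxE; ring.
rewrite mulrCA mulfV ?mulr1// -big_split/=.
rewrite (eq_bigr (fun i => 2 * (\sum_j X i j * (y 0 i * y 0 j) +
    \sum_j X i j * (z 0 i * z 0 j)))); last first.
  move=> i _; rewrite -!big_split/= mulr_sumr; apply: eq_bigr => j _.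
  by rewrite !mxE; ring.
by rewrite -mulr_sumr mulrC mulKf.
Qed.

Lemma quartic_ge (R : realType) (N : nat) (h : R) (y : 'rV[R]_N) :
  h ^+ 2 <= quartic h y.
Proof. by rewrite lerDr sumr_ge0// => i _; exact: exprn_even_ge0. Qed.

Lemma quartic_ge0 (R : realType) (N : nat) (h : R) (y : 'rV[R]_N) :
  0 <= quartic h y.
Proof. by rewrite (le_trans _ (quartic_ge _ _))// sqr_ge0. Qed.

(** In each coordinate [2 h y_i^2 <= y_i^4 + h^2]. Up to a factor the sum of squares is the
    Laplacian of the quartic, so diffusion makes the quartic grow at a relative rate of order
    [1 / h]. *)
Lemma sum_sqr_quartic (R : realType) (N : nat) (h : R) (y : 'rV[R]_N) : 0 < h ->
  h * \sum_i y 0 i ^+ 2 <= N.+1%:R / 2 * quartic h y.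
Proof.
move=> h0.
have H i : h * y 0 i ^+ 2 <= (y 0 i ^+ 4 + h ^+ 2) / 2.
  have := sqr_ge0 (y 0 i ^+ 2 - h); nra.
rewrite mulr_sumr (le_trans (ler_sum _ (fun i _ => H i)))//.
rewrite -mulr_suml big_split/= sumr_const card_ord -[h ^+ 2 *+ N]mulr_natl mulrAC.
rewrite ler_pM2r ?invr_gt0// /quartic mulrDr lerD//.
  by rewrite ler_peMl ?sumr_ge0// => [i _|]; [exact: exprn_even_ge0|rewrite ler1n].
by rewrite ler_wpM2r ?sqr_ge0// ler_nat.
Qed.

Lemma norm4_le (R : realType) (N : nat) (y : 'rV[R]_N) :
  `|y| ^+ 4 <= \sum_i y 0 i ^+ 4.
Proof.
have [->|y0] := eqVneq y 0.
  by rewrite normr0 expr0n/= sumr_ge0// => i _; exact: exprn_even_ge0.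
have [[i j] /= E] : exists i : 'I_1 * 'I_N, `|y| = `|y i.1 i.2|.
  by apply: mx_norm_neq0; apply: contra_neq y0; exact: mx_norm_eq0.
rewrite (ord1 i) in E; rewrite E (bigD1 j)//=.
rewrite -[X in X <= _]ger0_norm ?exprn_ge0// -normrX normr_id ger0_norm ?exprn_even_ge0//.
by rewrite lerDl sumr_ge0// => k _; exact: exprn_even_ge0.
Qed.

Lemma cube_quartic (R : realType) (N : nat) (h : R) (y : 'rV[R]_N) : 0 < h ->
  Num.sqrt h * `|y| ^+ 3 <= quartic h y.
Proof.
move=> h0; pose a := Num.sqrt h; have a0 : 0 <= a by exact: sqrtr_ge0.
have -> : h = a ^+ 2 by rewrite sqr_sqrtr// ltW.
rewrite sqrtr_sqr ger0_norm//.
rewrite /quartic (le_trans _ (lerD (norm4_le y) (lexx _)))//.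
have n0 : 0 <= `|y| by [].
move: (`|y|) n0 => b b0.
(* What remains is [a b^3 <= b^4 + a^4]; the fourth power of the larger of [a] and [b] suffices. *)
have [ab|/ltW ba] := leP a b.
  apply: (@le_trans _ _ (b ^+ 4)); last by rewrite lerDl exprn_ge0// exprn_ge0.
  by rewrite [leRHS]exprS ler_wpM2r// exprn_ge0.
apply: (@le_trans _ _ (a ^+ 4)); last by rewrite -exprM lerDr exprn_ge0.
by rewrite [leRHS]exprS ler_wpM2l// lerXn2r.
Qed.

Definition quad_diag (R : realType) (N : nat) (X : 'M[R]_N) (s : 'rV[R]_N) : R :=
  \sum_i \sum_j X i j * (s 0 i * s 0 j).

(** With steps of length [sqrt (2 k)] a quadratic polynomial with Hessian [X] gains [k s X s^T], the
    effect during the time [k] of the diffusion with matrix [s^T s]; the equation has no factor 1/2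
    before the trace. *)
Definition avg (R : realType) (N : nat) (k : R) (s : 'rV[R]_N)
    (V : 'rV[R]_N -> R) : 'rV[R]_N -> R :=
  fun x => (V (x + Num.sqrt (2 * k) *: s) + V (x - Num.sqrt (2 * k) *: s)) / 2.

Definition walk (R : realType) (N : nat) (k : R) (l : seq 'rV[R]_N)
    (V : 'rV[R]_N -> R) : 'rV[R]_N -> R := foldr (avg k) V l.

Definition walk_rate (R : realType) (N : nat) (B : R) : R :=
  6 * B * N.+1%:R + 4 * B ^+ 2 * N%:R.

(** The quadratic part is exact, and in the fourth powers only even powers of the step survive. The
    terms in [k y_i^2] are absorbed by [sum_sqr_quartic], those in [k^2] by [k <= h] and
    [h^2 <= quartic h y]; [walk_rate] collects both. *)
Lemma avg_touch (R : realType) (N : nat) (k h B c kap : R) (s p : 'rV[R]_N) X (V : 'rV[R]_N -> R) (x : 'rV[R]_N) :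
  0 < h -> 0 <= k -> k <= h -> 0 <= B -> (forall i, s 0 i ^+ 2 <= B) -> 0 <= kap ->
  (forall y, V (x + y) <= c + quad p X y + kap * quartic h y) ->
  forall y, avg k s V (x + y) <= c + k * quad_diag X s + quad p X y +
    kap * (1 + walk_rate N B * (k / h)) * quartic h y.
Proof.
move=> h0 k0 kh B0 sB kap0 VE y; rewrite /avg.
set z := Num.sqrt _ *: s.
have z2 i j : z 0 i * z 0 j = 2 * k * (s 0 i * s 0 j).
  by rewrite !mxE mulrACA -expr2 sqr_sqrtr// mulr_ge0.
have zE : \sum_i \sum_j X i j * (z 0 i * z 0 j) = 2 * k * quad_diag X s.
  rewrite /quad_diag mulr_sumr; apply: eq_bigr => i _; rewrite mulr_sumr.
  by apply: eq_bigr => j _; rewrite z2; ring.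
have H1 := VE (y + z); have H2 := VE (y - z).
rewrite [x + _]addrA in H1; rewrite [x + _]addrA in H2.
have Q := quad_parallelogram p X y z; rewrite zE in Q.
suff T : quartic h (y + z) + quartic h (y - z) <=
    2 * ((1 + walk_rate N B * (k / h)) * quartic h y).
  have := ler_wpM2l kap0 T; rewrite mulrDr; lra.
have Ti i : (y + z) 0 i ^+ 4 + (y - z) 0 i ^+ 4 <=
    2 * (y 0 i ^+ 4 + 12 * k * B * y 0 i ^+ 2 + 4 * k ^+ 2 * B ^+ 2).
  have z2i : z 0 i ^+ 2 = 2 * k * s 0 i ^+ 2 by rewrite !expr2 z2.
  rewrite mxE [(y - z) 0 i]mxE [(- z) 0 i]mxE.
  have -> : (y 0 i + z 0 i) ^+ 4 + (y 0 i - z 0 i) ^+ 4 =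
    2 * (y 0 i ^+ 4 + 6 * y 0 i ^+ 2 * z 0 i ^+ 2 + (z 0 i ^+ 2) ^+ 2) by ring.
  rewrite z2i; have := sB i; have := sqr_ge0 (s 0 i).
  move: (s 0 i ^+ 2) => t t0 tB; have y0 := sqr_ge0 (y 0 i).
  rewrite ler_wpM2l// lerD//.
    rewrite lerD2l (_ : 6 * _ * _ = 12 * k * t * y 0 i ^+ 2); last by ring.
    by rewrite !ler_wpM2r// ler_wpM2l// mulr_ge0.
  rewrite (_ : (2 * k * t) ^+ 2 = 4 * k ^+ 2 * t ^+ 2); last by ring.
  by rewrite ler_wpM2l ?mulr_ge0 ?sqr_ge0// lerXn2r.
have T1 : quartic h (y + z) + quartic h (y - z) <=
    2 * (quartic h y + 12 * k * B * (\sum_i y 0 i ^+ 2) + 4 * k ^+ 2 * B ^+ 2 * N%:R).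
  rewrite /quartic addrACA -big_split/= (le_trans (lerD (ler_sum _ (fun i _ => Ti i)) (lexx _)))//.
  rewrite -mulr_sumr !big_split/= sumr_const card_ord -[_ *+ N]mulr_natr -mulr_sumr.
  by rewrite le_eqVlt; apply/orP; left; apply/eqP; ring.
apply: (le_trans T1); rewrite ler_wpM2l//.
have S := sum_sqr_quartic y h0.
have kh0 : 0 <= k / h by rewrite divr_ge0// ltW.
have q2 := quartic_ge h y.
have A1 : 12 * k * B * (\sum_i y 0 i ^+ 2) <= 6 * B * N.+1%:R * (k / h) * quartic h y.
  have := ler_wpM2l (mulr_ge0 (mulr_ge0 (ler0n _ 12) B0) kh0) S.
  congr (_ <= _); first by field; rewrite gt_eqF.
  by field; rewrite gt_eqF.
have A2 : 4 * k ^+ 2 * B ^+ 2 * N%:R <= 4 * B ^+ 2 * N%:R * (k / h) * quartic h y.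
  have k2 : k ^+ 2 <= k / h * quartic h y.
    apply: (le_trans _ (ler_wpM2l kh0 q2)).
    rewrite (_ : k / h * h ^+ 2 = k * h) ?expr2 ?ler_wpM2l//.
    by field; rewrite gt_eqF.
  have c0 : 0 <= 4 * B ^+ 2 * N%:R by rewrite !mulr_ge0 ?sqr_ge0.
  have := ler_wpM2l c0 k2; congr (_ <= _); ring.
rewrite /walk_rate; lra.
Qed.

Lemma walk_rate_ge0 (R : realType) (N : nat) (B : R) : 0 <= B -> 0 <= walk_rate N B.
Proof. by move=> B0; rewrite addr_ge0// ?mulr_ge0// ?sqr_ge0. Qed.

Lemma walk_cat (R : realType) (N : nat) (k : R) (l1 l2 : seq 'rV[R]_N) V :
  walk k (l1 ++ l2) V = walk k l1 (walk k l2 V).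
Proof. exact: foldr_cat. Qed.

Lemma walk_touch (R : realType) (N : nat) (k h B c kap : R) (l : seq 'rV[R]_N)
    (p : 'rV[R]_N) X (V : 'rV[R]_N -> R) (x : 'rV[R]_N) :
  0 < h -> 0 <= k -> k <= h -> 0 <= B ->
  (forall s i, s \in l -> s 0 i ^+ 2 <= B) -> 0 <= kap ->
  (forall y, V (x + y) <= c + quad p X y + kap * quartic h y) ->
  forall y, walk k l V (x + y) <=
    c + k * \sum_(s <- l) quad_diag X s + quad p X y +
    kap * (1 + walk_rate N B * (k / h)) ^+ size l * quartic h y.
Proof.
move=> h0 k0 kh B0 lB kap0 VE; elim: l lB => [|s l IH] lB.
  by move=> y; rewrite big_nil expr0 mulr1 mulr0 addr0; exact: VE.
have w0 : 0 <= 1 + walk_rate N B * (k / h).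
  apply: addr_ge0 => //; apply: mulr_ge0; first exact: walk_rate_ge0.
  by apply: divr_ge0 => //; exact: ltW.
have sB i : s 0 i ^+ 2 <= B by apply: lB; rewrite mem_head.
have lB' t i : t \in l -> t 0 i ^+ 2 <= B.
  by move=> tl; apply: lB; rewrite inE tl orbT.
have kap1 : 0 <= kap * (1 + walk_rate N B * (k / h)) ^+ size l.
  by rewrite mulr_ge0// exprn_ge0.
move=> y; apply: (le_trans (avg_touch h0 k0 kh B0 sB kap1 (IH lB') y)).
by rewrite big_cons /= exprS le_eqVlt; apply/orP; left; apply/eqP; ring.
Qed.

Lemma walk_cst (R : realType) (N : nat) (k c : R) (l : seq 'rV[R]_N) V :
  walk k l (fun x => V x + c) = fun x => walk k l V x + c.
Proof.
elim: l => //= s l ->; apply/funext => x; rewrite /avg.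
by field.
Qed.

Lemma walkN (R : realType) (N : nat) (k : R) (l : seq 'rV[R]_N) V :
  walk k l (fun x => - V x) = fun x => - walk k l V x.
Proof.
elim: l => //= s l ->; apply/funext => x; rewrite /avg.
by field.
Qed.

Lemma avgC (R : realType) (N : nat) (k : R) (s t : 'rV[R]_N) V :
  avg k s (avg k t V) = avg k t (avg k s V).
Proof.
apply/funext => x; rewrite /avg; set r := Num.sqrt _.
rewrite (addrAC x (r *: t) (r *: s)) (addrAC x (- (r *: t)) (r *: s)).
rewrite (addrAC x (r *: t) (- (r *: s))) (addrAC x (- (r *: t)) (- (r *: s))).
by field.
Qed.

Lemma walkC (R : realType) (N : nat) (k : R) (l1 l2 : seq 'rV[R]_N) V :
  walk k l1 (walk k l2 V) = walk k l2 (walk k l1 V).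
Proof.
have H s l W : walk k l (avg k s W) = avg k s (walk k l W).
  by elim: l => //= t l ->; rewrite avgC.
by elim: l1 => //= s l1 ->; rewrite H.
Qed.

Definition rep (T : Type) (m : nat) (l : seq T) : seq T := flatten (nseq m l).

Lemma repS (T : Type) (m : nat) (l : seq T) : rep m.+1 l = l ++ rep m l.
Proof. by []. Qed.

Lemma size_rep (T : Type) (m : nat) (l : seq T) : size (rep m l) = (m * size l)%N.
Proof. by elim: m => // m IH; rewrite repS size_cat IH mulSn. Qed.

Lemma mem_rep (T : eqType) (m : nat) (l : seq T) x : x \in rep m l -> x \in l.
Proof. by elim: m => // m IH; rewrite repS mem_cat => /orP[]. Qed.

Lemma sum_rep (R : realType) (T : Type) (m : nat) (l : seq T) (f : T -> R) :
  \sum_(s <- rep m l) f s = m%:R * \sum_(s <- l) f s.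
Proof.
elim: m => [|m IH]; first by rewrite big_nil mul0r.
by rewrite repS big_cat/= IH -natr1 mulrDl mul1r addrC.
Qed.

(** Averages of translations commute, so alternating rounds can be sorted. The walk of a pair of
    controls is thus the walk of the second control followed by that of the first, as in the
    splitting scheme. *)
Lemma walk_rep_cat (R : realType) (N : nat) (k : R) (m : nat) (l1 l2 : seq 'rV[R]_N) V :
  walk k (rep m (l1 ++ l2)) V = walk k (rep m l1) (walk k (rep m l2) V).
Proof.
elim: m => // m IH.
by rewrite !repS !walk_cat IH (walkC _ l2).
Qed.

Lemma walk_lip (R : realType) (N : nat) (k L : R) (l : seq 'rV[R]_N) V :
  lip L V -> lip L (walk k l V).
Proof.
move=> VL; elim: l => //= s l IH x y; rewrite /avg -mulrBl normrM.
rewrite [`|2^-1|]gtr0_norm ?invr_gt0// ler_pdivrMr//.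
rewrite opprD addrACA (le_trans (ler_normD _ _))// mulr_natr mulr2n.
by apply: lerD; [exact: (lip_shift _ IH)|exact: (lip_shift (- _) IH)].
Qed.

Lemma walk_bound (R : realType) (N : nat) (k b : R) (l : seq 'rV[R]_N) V :
  (forall x, `|V x| <= b) -> forall x, `|walk k l V x| <= b.
Proof.
move=> Vb; elim: l => //= s l IH x; rewrite /avg normrM.
rewrite [`|2^-1|]gtr0_norm ?invr_gt0// ler_pdivrMr// (le_trans (ler_normD _ _))//.
by rewrite mulr_natr mulr2n lerD.
Qed.

Definition molr (R : realType) (N : nat) (eps : R) :=
  mol eps (fun i : 'I_N => delta_mx 0 i : 'rV[R]_N) (enum 'I_N).

Lemma norm_delta (R : realType) (N : nat) (i : 'I_N) :
  `|delta_mx 0 i : 'rV[R]_N| <= 1.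
Proof.
apply: norm_rV_le => // j; rewrite mxE eqxx/=.
by case: (j == i); rewrite ?normr1 ?normr0.
Qed.

Lemma molr_walk (R : realType) (N : nat) (eps k : R) (l : seq 'rV[R]_N) V :
  0 < eps -> islip V -> molr eps (walk k l V) = walk k l (molr eps V).
Proof.
move=> e0 Vl; elim: l => //= s l <-.
have Wl : islip (walk k l V) by case: Vl => L /(walk_lip k l) ?; exists L.
have Ml : linop (@molr R N eps) by exact: mol_linop.
have Ws z : islip (fun x => walk k l V (x + z)).
  by case: Wl => L /(lip_shift z) ?; exists L.
rewrite (_ : avg k s _ = fun x => 2^-1 *
   (walk k l V (x + Num.sqrt (2 * k) *: s) + walk k l V (x - Num.sqrt (2 * k) *: s))).
  rewrite linopZ ?linopD//; last exact: islip_add.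
  by rewrite /molr !(mol_shift _ _ _ _ (walk k l V)); apply/funext => x; rewrite /avg mulrC.
by apply/funext => x; rewrite /avg mulrC.
Qed.

Lemma molr_taylor (R : realType) (N : nat) (eps L : R) (V : 'rV[R]_N -> R) x :
  0 < eps -> 0 <= L -> lip L V ->
  exists (p : 'rV[R]_N) (X : 'M[R]_N), X^T = X /\
    forall y, `|molr eps V (x + y) - (molr eps V x + quad p X y)| <=
      4 * N.+1%:R ^+ 3 * L / eps ^+ 2 * `|y| ^+ 3.
Proof.
move=> e0 L0 VL.
have [p [X [_ _ H]]] := mol_taylor (enum 'I_N) e0 (@norm_delta R N) L0 VL.
(* The form given by [mol_taylor] has no factor 1/2 and need not be symmetric; adding the transpose
   repairs both. *)
exists (\row_i p i x), (\matrix_(i, j) (X (i, j) x + X (j, i) x)); split.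
  by apply/matrixP => i j; rewrite !mxE addrC.
move=> y; have [] := H x (fun i => y 0 i) `|y| (normr_ge0 _) (fun i => norm_coord _ _ _).
rewrite /= big_enum/= -row_sum_delta size_enum_ord natr1 => _.
congr (`|_| <= _); rewrite -!addrA; congr (_ + _); rewrite opprD; congr (_ + _).
rewrite -opprD; congr (- _); rewrite /quad; congr (_ + _).
  by apply: eq_bigr => i _; rewrite mxE mulrC.
have -> : \sum_k (y 0 k.1 * y 0 k.2) * X k x = \sum_i \sum_j y 0 i * y 0 j * X (i, j) x.
  by rewrite pair_bigA; apply: eq_bigr => -[].
have -> : \sum_i \sum_j (\matrix_(i, j) (X (i, j) x + X (j, i) x)) i j * (y 0 i * y 0 j)
   = \sum_i \sum_j y 0 i * y 0 j * X (i, j) x + \sum_i \sum_j y 0 i * y 0 j * X (j, i) x.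
  rewrite -big_split/=; apply: eq_bigr => i _; rewrite -big_split/=.
  by apply: eq_bigr => j _; rewrite mxE; ring.
rewrite [X in _ + X]exchange_big/=.
under [X in _ + X]eq_bigr do under eq_bigr do rewrite (mulrC (y 0 _) (y 0 _)).
by rewrite -mulr2n -[_ *+ 2]mulr_natr mulfK.
Qed.

(* One step of the value iteration for controls frozen during the time [m * k];
   a walk of [m] rounds replaces the diffusion, and [m] tends to infinity before
   the time step [m * k] tends to zero. *)
Definition policy (R : realType) (N : nat) (D : Type) (k : R) (m : nat)
    (s : D -> seq 'rV[R]_N) (f : D -> R) (V : 'rV[R]_N -> R) : 'rV[R]_N -> R :=
  fun x => inf (range (fun d => walk k (rep m (s d)) V x + m%:R * k * f d)).

(** The bounds on [V] and [f] keep the set of values bounded below, so that [inf] is a true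
    infimum. *)
Lemma policy_le (R : realType) (N : nat) (D : Type) (k b F : R) (m : nat)
    (s : D -> seq 'rV[R]_N) (f : D -> R) V d x : 0 <= k ->
  (forall d, `|f d| <= F) -> (forall x, `|V x| <= b) ->
  policy k m s f V x <= walk k (rep m (s d)) V x + m%:R * k * f d.
Proof.
move=> k0 fF Vb; apply: ge_inf; last by exists d.
exists (- (b + m%:R * k * F)) => _ [d' _ <-].
rewrite opprD; apply: lerD.
  by have := walk_bound k (rep m (s d')) Vb x; rewrite ler_norml => /andP[].
rewrite -mulrN ler_wpM2l ?mulr_ge0//.
by have := fF d'; rewrite ler_norml => /andP[].
Qed.

Lemma policy_ge (R : realType) (N : nat) (D : Type) (k c : R) (m : nat)
    (s : D -> seq 'rV[R]_N) (f : D -> R) V x : inhabited D ->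
  (forall d, c <= walk k (rep m (s d)) V x + m%:R * k * f d) ->
  c <= policy k m s f V x.
Proof.
move=> [d0] H; apply: lb_le_inf; first by exists (walk k (rep m (s d0)) V x + m%:R * k * f d0), d0.
by move=> _ [d _ <-].
Qed.

(** Walks preserve the constant [L], costs do not depend on the point, and an infimum of functions
    with constant [L] has this constant again. Hence one [L] serves for all iterates. *)
Lemma policy_lip (R : realType) (N : nat) (D : Type) (k b F L : R) (m : nat)
    (s : D -> seq 'rV[R]_N) (f : D -> R) V : inhabited D -> 0 <= k ->
  (forall d, `|f d| <= F) -> (forall x, `|V x| <= b) -> lip L V ->
  lip L (policy k m s f V).
Proof.
move=> D0 k0 fF Vb VL.
have H x y : policy k m s f V x - policy k m s f V y <= L * `|x - y|.
  rewrite lerBlDr -lerBlDl; apply: policy_ge => // d.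
  rewrite lerBlDl (le_trans (policy_le m s d x k0 fF Vb))// addrA lerD2r.
  rewrite -lerBlDr (le_trans (ler_norm _))//.
  exact: walk_lip.
by move=> x y; rewrite ler_norml lerNl opprB H distrC H.
Qed.

Lemma policy_bound (R : realType) (N : nat) (D : Type) (k b F : R) (m : nat)
    (s : D -> seq 'rV[R]_N) (f : D -> R) V : inhabited D -> 0 <= k ->
  (forall d, `|f d| <= F) -> (forall x, `|V x| <= b) ->
  forall x, `|policy k m s f V x| <= b + m%:R * k * F.
Proof.
move=> [d0] k0 fF Vb x; rewrite ler_norml; apply/andP; split.
  apply: policy_ge => // d; rewrite opprD; apply: lerD.
    by have := walk_bound k (rep m (s d)) Vb x; rewrite ler_norml => /andP[].
  rewrite -mulrN ler_wpM2l ?mulr_ge0//.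
  by have := fF d; rewrite ler_norml => /andP[].
rewrite (le_trans (policy_le m s d0 x k0 fF Vb))//; apply: lerD.
  by have := walk_bound k (rep m (s d0)) Vb x; rewrite ler_norml => /andP[].
rewrite ler_wpM2l ?mulr_ge0//.
by have := fF d0; rewrite ler_norml => /andP[].
Qed.

Lemma policy_iter (R : realType) (N : nat) (D : Type) (k b F L : R) (m : nat)
    (s : D -> seq 'rV[R]_N) (f : D -> R) V : inhabited D -> 0 <= k ->
  (forall d, `|f d| <= F) -> (forall x, `|V x| <= b) -> lip L V -> forall j,
  lip L (iter j (policy k m s f) V) /\
    exists b', forall x, `|iter j (policy k m s f) V x| <= b'.
Proof.
move=> D0 k0 fF Vb VL; elim=> [|j [IH1 [b' IH2]]]; first by split => //; exists b.
split; first exact: policy_lip fF IH2 IH1.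
by exists (b' + m%:R * k * F); exact: policy_bound.
Qed.

(** * Barriers for viscosity solutions *)

(** In space directions the barriers are polynomials of degree at most four, so an exact expansion
    yields the derivative without chain rules. *)
Lemma is_derive_expand (R : realType) (V : normedModType R) (f : V -> R) z v
    (d c2 c3 c4 : R) :
  (forall h : R, f (z + h *: v) = f z + h * d + h ^+ 2 * (c2 + c3 * h + c4 * h ^+ 2)) ->
  is_derive z v f d.
Proof.
move=> H.
have L : h^-1 *: ((f \o shift z) (h *: v) - f z) @[h --> (0:R)^'] --> d.
  have C : (d + h * (c2 + c3 * h + c4 * h ^+ 2)) @[h --> (0:R)^'] --> d.
    pose g (h : R) := d + h * (c2 + c3 * h + c4 * h ^+ 2).
    have g0 : g 0 = d by rewrite /g mul0r addr0.
    rewrite -[X in _ --> X]g0; apply/continuous_withinNx.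
    apply: cvgD; first exact: cvg_cst.
    apply: cvgM; first exact: cvg_id.
    apply: cvgD; last by apply: cvgM; [exact: cvg_cst|exact: exprn_continuous].
    by apply: cvgD; [exact: cvg_cst|apply: cvgM; [exact: cvg_cst|exact: cvg_id]].
  apply: cvg_trans C; apply: near_eq_cvg; near=> h.
  have h0 : h != 0 by near: h; exact: nbhs_dnbhs_neq.
  rewrite /= (addrC (h *: v)) H [LHS]/=.
  by rewrite /GRing.scale/=; field.
split; first by apply/cvg_ex; exists d.
exact: cvg_lim.
Unshelve. all: by end_near. Qed.

(** * Explicit test functions and their derivatives *)

Lemma is_derive_time (R : realType) (N : nat) (f : R -> R) (d : R) (z : R * 'rV[R]_N) :
  is_derive z.1 1 f d -> is_derive z (time_dir R N) (fun w => f w.1) d.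
Proof.
move=> [D E].
have H : (fun h => h^-1 *: (((fun w : R * 'rV[R]_N => f w.1) \o shift z) (h *: time_dir R N) - f z.1))
   = (fun h => h^-1 *: ((f \o shift z.1) (h *: 1) - f z.1)).
  by apply/funext.
split; first by rewrite /derivable H.
by rewrite /derive H.
Qed.

Definition bump (R : realType) (N : nat) (A E : R -> R) (p : 'rV[R]_N) (X : 'M[R]_N)
    (x0 : 'rV[R]_N) : R * 'rV[R]_N -> R :=
  fun z => A z.1 + quad p X (z.2 - x0) + E z.1 * \sum_i (z.2 - x0) 0 i ^+ 4.

Lemma coord_cont (R : realType) (N : nat) (x0 : 'rV[R]_N) i :
  continuous (fun z : R * 'rV[R]_N => (z.2 - x0) 0 i).
Proof.
move=> z; rewrite (_ : (fun _ => _) = fun w : R * 'rV[R]_N => w.2 0 i - x0 0 i); last first.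
  by apply/funext => w; rewrite !mxE.
apply: cvgB; last exact: cvg_cst.
apply: (@cvg_comp _ _ _ snd (fun x : 'rV[R]_N => x 0 i)); first exact: cvg_snd.
exact: coord_continuous.
Qed.

Lemma sum_cont (R : realType) (T : topologicalType) (I : finType) (f : I -> T -> R) :
  (forall i, continuous (f i)) -> continuous (fun z => \sum_i f i z).
Proof.
move=> fc z; rewrite (_ : (fun z => _) = \sum_i f i); last first.
  by apply/funext => w; rewrite fct_sumE.
by apply: (big_ind (fun g : T -> R => {for z, continuous g})) => [|g1 g2 c1 c2|i _];
  [exact: cst_continuous|exact: continuousD|exact: fc].
Qed.

Lemma time_cont (R : realType) (N : nat) (A : R -> R) : continuous A ->
  continuous (fun z : R * 'rV[R]_N => A z.1).
Proof.
move=> Ac z; apply: (@cvg_comp _ _ _ fst A); first exact: cvg_fst.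
exact: Ac.
Qed.

Lemma coord_pow_cont (R : realType) (N n : nat) (x0 : 'rV[R]_N) i :
  continuous (fun z : R * 'rV[R]_N => (z.2 - x0) 0 i ^+ n).
Proof.
move=> z; apply: (@cvg_comp _ _ _ (fun z : R * 'rV[R]_N => (z.2 - x0) 0 i) (fun x => x ^+ n)).
  exact: coord_cont.
exact: exprn_continuous.
Qed.

Lemma quad_cont (R : realType) (N : nat) (p : 'rV[R]_N) (X : 'M[R]_N) (x0 : 'rV[R]_N) :
  continuous (fun z : R * 'rV[R]_N => quad p X (z.2 - x0)).
Proof.
move=> z; apply: cvgD.
  apply: sum_cont => i w; apply: cvgM; first exact: cvg_cst.
  exact: coord_cont.
apply: cvgM; last exact: cvg_cst.
apply: sum_cont => i; apply: sum_cont => j w.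
apply: cvgM; first exact: cvg_cst.
by apply: cvgM; exact: coord_cont.
Qed.

Lemma space_shift (R : realType) (N : nat) (z : R * 'rV[R]_N) (x0 : 'rV[R]_N) (h : R) i j :
  ((z + h *: space_dir R i).2 - x0) 0 j = (z.2 - x0) 0 j + h * (i == j)%:R.
Proof. by rewrite !mxE /= ?mxE eq_sym addrAC. Qed.

Lemma space_shift1 (R : realType) (N : nat) (z : R * 'rV[R]_N) (h : R) (i : 'I_N) :
  (z + h *: space_dir R i).1 = z.1.
Proof. by rewrite /= scaler0 addr0. Qed.

Section bump_derivatives.
Context (R : realType) (N : nat) (A dA E dE : R -> R).
Context (p : 'rV[R]_N) (X : 'M[R]_N) (x0 : 'rV[R]_N).
Hypothesis AE : forall s : R, is_derive s 1 A (dA s).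
Hypothesis EE : forall s : R, is_derive s 1 E (dE s).
Hypothesis dAc : continuous dA.
Hypothesis dEc : continuous dE.
Hypothesis XT : X^T = X.
Let phi := bump A E p X x0.

Let Ac : continuous A. Proof. by move=> s; exact: is_derive_continuous (AE s). Qed.
Let Ec : continuous E. Proof. by move=> s; exact: is_derive_continuous (EE s). Qed.

Lemma bump_time z : is_derive z (time_dir R N) phi
  (dA z.1 + dE z.1 * \sum_i (z.2 - x0) 0 i ^+ 4).
Proof.
have cst (g : 'rV[R]_N -> R) : is_derive z (time_dir R N) (fun w => g w.2) 0.
  apply: (@is_derive_expand _ _ _ _ _ 0 0 0 0) => h.
  by rewrite /= scaler0 !addr0 !mulr0 !mul0r !addr0 mulr0 addr0.
rewrite [dE z.1 * _]mulrC.
have := is_deriveD (is_deriveD (is_derive_time (AE z.1)) (cst (fun x => quad p X (x - x0))))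
  (is_deriveM (is_derive_time (EE z.1)) (cst (fun x => \sum_i (x - x0) 0 i ^+ 4))).
by rewrite /GRing.scale/= mulr0 !addr0 add0r; exact.
Qed.

Lemma bump_space i z : is_derive z (space_dir R i) phi
  (p 0 i + \sum_j X i j * (z.2 - x0) 0 j + 4 * E z.1 * (z.2 - x0) 0 i ^+ 3).
Proof.
set y := z.2 - x0.
apply: (@is_derive_expand _ _ _ _ _ _ (X i i / 2 + 6 * E z.1 * y 0 i ^+ 2) (4 * E z.1 * y 0 i) (E z.1)) => h.
rewrite /phi /bump space_shift1 -/y.
have Q : quad p X ((z + h *: space_dir R i).2 - x0) =
    quad p X y + h * (p 0 i + \sum_j X i j * y 0 j) + h ^+ 2 * (X i i / 2).
  have Xs j k : X j k = X k j by rewrite -[in LHS]XT mxE.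
  have sd (F : 'I_N -> R) : \sum_j F j * (h * (i == j)%:R) = h * F i.
    rewrite (bigD1 i)//= big1 ?addr0 ?eqxx ?mulr1 1?mulrC// => k.
    by rewrite eq_sym => /negbTE ->; rewrite !mulr0.
  rewrite /quad; under eq_bigr do rewrite space_shift -/y mulrDr.
  rewrite big_split/= sd.
  have -> : \sum_j \sum_k X j k * (((z + h *: space_dir R i).2 - x0) 0 j *
      ((z + h *: space_dir R i).2 - x0) 0 k) =
      \sum_j ((\sum_k X j k * (y 0 j * y 0 k)) + h * (X i j * y 0 j)) +
      \sum_j (\sum_k X j k * y 0 k + h * X j i) * (h * (i == j)%:R).
    rewrite -big_split/=; apply: eq_bigr => j _.
    rewrite space_shift -/y (Xs i j) (eq_bigr (fun k => X j k * (y 0 j * y 0 k) +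
      (X j k * y 0 j) * (h * (i == k)%:R) + (X j k * y 0 k) * (h * (i == j)%:R) +
      (h * (i == j)%:R * X j k) * (h * (i == k)%:R))); last first.
      by move=> k _; rewrite space_shift -/y; ring.
    by rewrite !big_split/= !sd -mulr_suml; ring.
  by rewrite sd big_split/= -mulr_sumr; field.
have S : \sum_j ((z + h *: space_dir R i).2 - x0) 0 j ^+ 4 =
    \sum_j y 0 j ^+ 4 + h * (4 * y 0 i ^+ 3) + h ^+ 2 * (6 * y 0 i ^+ 2 + 4 * y 0 i * h + h ^+ 2).
  rewrite (bigD1 i)//= [in RHS](bigD1 i)//= space_shift eqxx mulr1 -/y.
  rewrite [X in _ + X = _](eq_bigr (fun j => y 0 j ^+ 4)); first by ring.
  by move=> j /negbTE ji; rewrite space_shift eq_sym ji mulr0 addr0.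
by rewrite Q S; ring.
Qed.

Lemma bump_space2 i j z : is_derive z (space_dir R j)
  (fun z => p 0 i + \sum_j X i j * (z.2 - x0) 0 j + 4 * E z.1 * (z.2 - x0) 0 i ^+ 3)
  (X i j + (i == j)%:R * (12 * E z.1 * (z.2 - x0) 0 i ^+ 2)).
Proof.
set y := z.2 - x0.
apply: (@is_derive_expand _ _ _ _ _ _ ((i == j)%:R * (12 * E z.1 * y 0 i)) ((i == j)%:R * (4 * E z.1)) 0) => h.
rewrite space_shift1 space_shift -/y.
have -> : \sum_k X i k * ((z + h *: space_dir R j).2 - x0) 0 k =
    \sum_k X i k * y 0 k + h * X i j.
  under eq_bigr do rewrite space_shift -/y mulrDr.
  rewrite big_split/=; congr (_ + _).
  rewrite (bigD1 j)//= big1 ?addr0 ?eqxx ?mulr1 1?mulrC// => k.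
  by rewrite eq_sym => /negbTE ->; rewrite !mulr0.
by rewrite eq_sym; case: eqVneq => _; rewrite ?mulr1 ?mulr0 ?mul1r ?mul0r; ring.
Qed.

Lemma bump_time_derivative z : time_derivative phi z =
  dA z.1 + dE z.1 * \sum_i (z.2 - x0) 0 i ^+ 4.
Proof. exact: (derive_val (is_derive := bump_time z)). Qed.

Lemma bump_partial i : partial i phi =
  fun z => p 0 i + \sum_j X i j * (z.2 - x0) 0 j + 4 * E z.1 * (z.2 - x0) 0 i ^+ 3.
Proof. by apply/funext => z; exact: (derive_val (is_derive := bump_space i z)). Qed.

Lemma bump_partial2 i j : partial j (partial i phi) =
  fun z => X i j + (i == j)%:R * (12 * E z.1 * (z.2 - x0) 0 i ^+ 2).
Proof.
rewrite bump_partial.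
by apply/funext => z; exact: (derive_val (is_derive := bump_space2 i j z)).
Qed.

Lemma bump_hessian z : hessian phi z =
  X + diag_mx (\row_i (12 * E z.1 * (z.2 - x0) 0 i ^+ 2)).
Proof.
apply/matrixP => i j; rewrite [LHS]mxE bump_partial2 !mxE.
by case: eqVneq => [->|_]; rewrite ?mul1r ?mul0r ?mulr1n ?mulr0n.
Qed.

Lemma bump_C12 : C12 phi.
Proof.
have ec (c : R) : continuous (fun z : R * 'rV[R]_N => c * E z.1).
  by move=> z; apply: cvgM; [exact: cvg_cst|exact: time_cont].
split.
- move=> z; apply: cvgD.
    by apply: cvgD; [exact: time_cont|exact: quad_cont].
  apply: cvgM; first exact: time_cont.
  by apply: sum_cont => i; exact: coord_pow_cont.
- split; first by move=> z; exact: (@ex_derive _ _ _ _ _ _ _ (bump_time z)).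
  rewrite (_ : time_derivative phi = fun z => dA z.1 + dE z.1 * \sum_i (z.2 - x0) 0 i ^+ 4).
    move=> z; apply: cvgD; first exact: time_cont.
    apply: cvgM; first exact: time_cont.
    by apply: sum_cont => i; exact: coord_pow_cont.
  by apply/funext => z; exact: bump_time_derivative.
- move=> i; split; first by move=> z; exact: (@ex_derive _ _ _ _ _ _ _ (bump_space i z)).
  rewrite bump_partial => z; apply: cvgD; last first.
    by apply: cvgM; [exact: ec|exact: coord_pow_cont].
  apply: cvgD; first exact: cvg_cst.
  by apply: sum_cont => j w; apply: cvgM; [exact: cvg_cst|exact: coord_cont].
- move=> i j; split.
    by rewrite bump_partial => z; exact: (@ex_derive _ _ _ _ _ _ _ (bump_space2 i j z)).
  rewrite bump_partial2 => z; apply: cvgD; first exact: cvg_cst.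
  apply: cvgM; first exact: cvg_cst.
  by apply: cvgM; [exact: ec|exact: coord_pow_cont].
Qed.

End bump_derivatives.

(** The quartic penalty beats the quadratic polynomial at infinity, which confines the maximum of
    barrier minus solution to a compact set. The value of [U] comes from completing the square in
    [|y|^2]. *)
Lemma quad_bound (R : realType) (N : nat) (p : 'rV[R]_N) (X : 'M[R]_N) (kap : R) :
  0 < kap -> exists U, forall y, quad p X y <= U + kap * `|y| ^+ 4.
Proof.
move=> k0.
pose a := \sum_i `|p 0 i|; pose b := (\sum_i \sum_j `|X i j|) / 2.
have a0 : 0 <= a by apply: sumr_ge0.
have b0 : 0 <= b by rewrite divr_ge0// sumr_ge0// => i _; apply: sumr_ge0.
exists (a + (a + b) ^+ 2 / (4 * kap)) => y.
have H : quad p X y <= a * `|y| + b * `|y| ^+ 2.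
  rewrite /quad; apply: lerD.
    rewrite /a mulr_suml; apply: ler_sum => i _; rewrite (le_trans (ler_norm _))// normrM ler_wpM2l//.
    exact: norm_coord.
  rewrite /b mulrAC ler_wpM2r ?invr_ge0// mulr_suml; apply: ler_sum => i _.
  rewrite mulr_suml; apply: ler_sum => j _.
  rewrite (le_trans (ler_norm _))// !normrM ler_wpM2l// expr2.
  by apply: ler_pM => //; exact: norm_coord.
apply: (le_trans H); move: (`|y|) (normr_ge0 y) => r r0.
have r1 : r <= 1 + r ^+ 2 by have := sqr_ge0 (r - 1); nra.
apply: (@le_trans _ _ (a + (a + b) * r ^+ 2)).
  by have := ler_wpM2l a0 r1; lra.
rewrite -addrA lerD2l -subr_ge0.
rewrite [leRHS](_ : _ = kap * (r ^+ 2 - (a + b) / (2 * kap)) ^+ 2).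
  by rewrite pmulr_rge0// sqr_ge0.
by field; rewrite gt_eqF.
Qed.

(* The equation can be used at all times up to and including [t]: either [I] goes
   beyond [t], or [t] is the last time of [I], where extrema only look back. *)
Definition horizon (R : realType) (I : set R) (t : R) :=
  (exists2 t', t < t' & forall s, 0 < s -> s <= t' -> I s) \/
  ((forall s, 0 < s -> s <= t -> I s) /\ forall s, I s -> s <= t).

(** The quartic has a nonnegative diagonal Hessian; this inequality bounds what subtracting such a
    matrix adds to the equation. *)
Definition elliptic (R : realType) (N : nat) (B : R) (G : 'M[R]_N -> R) :=
  forall (X : 'M[R]_N) (d : 'rV[R]_N), (forall i, 0 <= d 0 i) ->
    G (X - diag_mx d) <= G X + B * \sum_i d 0 i.

(** The factor 12 from the second derivative of a fourth power, times [N.+1 / 2] from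
    [sum_sqr_quartic]; the added 1 makes the barrier a strict subsolution. *)
Definition barrier_rate (R : realType) (N : nat) (B : R) : R := 6 * B * N.+1%:R + 1.

Lemma is_derive_expR_affine (R : realType) (a b : R) (s : R) :
  is_derive s 1 (fun s => expR (a * (s - b))) (a * expR (a * (s - b))).
Proof.
rewrite mulrC; apply: (@is_derive1_comp _ expR (fun s => a * (s - b))).
rewrite -[X in is_derive _ _ _ X]mulr1; apply: is_deriveZ.
by rewrite -[X in is_derive _ _ _ X]subr0; apply: is_deriveB.
Qed.

Lemma expR_affine_cont (R : realType) (a b : R) :
  continuous (fun s : R => expR (a * (s - b))).
Proof. by move=> s; exact: is_derive_continuous (is_derive_expR_affine a b s). Qed.

(* The penalty [eta * exp (M (s - t1))] keeps the maximum of the barrier minus [v]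
   away from the artificial final time [t2 > t1]; [eta] then tends to zero. *)
Lemma lower_barrier (R : realType) (N : nat) (B h c kap t0 t1 : R)
    (G : 'M[R]_N -> R) (I : set R) (v : R * 'rV[R]_N -> R)
    (p : 'rV[R]_N) (X : 'M[R]_N) (x0 : 'rV[R]_N) :
  0 <= B -> elliptic B G -> 0 < h -> 0 < kap -> X^T = X ->
  {within cylinder (0 |` I), continuous v} ->
  (forall tau, I tau -> [bounded v z | z in cylinder `[0, tau]]) ->
  visc_supersolution G I v ->
  horizon I t1 -> 0 <= t0 -> t0 < t1 ->
  (forall y, c + quad p X y - kap * quartic h y <= v (t0, x0 + y)) ->
  forall y, c - (t1 - t0) * G X + quad p X y
    - kap * expR (barrier_rate N B / h * (t1 - t0)) * quartic h y
    <= v (t1, x0 + y).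
Proof.
move=> B0 GB h0 kap0 XT vc vb vs Ih t00 t01 v0 y1.
apply/ler_addgt0Pr => eta eta0.
rewrite leNgt; apply/negP => contra.
have [t2 [t12 It2 t2P]] : exists t2, [/\ t1 <= t2, (forall s, 0 < s -> s <= t2 -> I s)
    & t1 < t2 \/ forall s, I s -> s <= t2].
  case: Ih => [[t2 t12 It2]|[It It1]].
    by exists t2; split => //; [exact: ltW|left].
  by exists t1; split => //; right.
have t20 : 0 < t2 by rewrite (lt_le_trans _ t12)// (le_lt_trans t00).
have [Mv vM] : exists M, forall s x, 0 <= s -> s <= t2 -> `|v (s, x)| <= M.
  have [M [_ vM]] := vb t2 (It2 _ t20 (lexx _)).
  exists (M + 1) => s x s0 st; apply: (vM (M + 1)); first by rewrite ltrDl.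
  by rewrite /cylinder/= in_itv/= s0.
(* Half of [kap] is spent on the quadratic part; the other half still drives the barrier to minus
   infinity. *)
have [U qU] : exists U, forall y, quad p X y <= U + kap / 2 * `|y| ^+ 4.
  by apply: quad_bound; rewrite divr_gt0.
pose lam := barrier_rate N B / h.
have lam0 : 0 < lam.
  by rewrite divr_gt0// /barrier_rate ltr_wpDl// !mulr_ge0.
(* [Cs] bounds barrier minus [v] before the remaining quartic and the exponential penalty are
   subtracted; the difference is negative wherever one of these exceeds [Cs]. *)
pose Cs := c + `|G X| * t2 + U + Mv.
have [M [M0 MP]] : exists M, 0 < M /\ (t1 < t2 -> Cs < eta * expR (M * (t2 - t1))).
  exists (`|Cs| / (eta * (t2 - t1)) + 1); split.
    by rewrite ltr_wpDl// divr_ge0// mulr_ge0 ?subr_ge0// ltW.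
  move=> t12'; have t12'' : 0 < t2 - t1 by rewrite subr_gt0.
  apply: (@lt_le_trans _ _ (eta * (1 + (`|Cs| / (eta * (t2 - t1)) + 1) * (t2 - t1)))).
    rewrite (_ : eta * _ = `|Cs| + eta * (1 + (t2 - t1))).
      by rewrite (le_lt_trans (ler_norm _))// ltrDl mulr_gt0// addr_gt0.
    by field; rewrite !gt_eqF.
  by rewrite ler_pM2l// expR_ge1Dx.
pose e s := expR (lam * (s - t0)).
pose A s := c - (s - t0) * G X - kap * h ^+ 2 * e s - eta * expR (M * (s - t1)).
pose dA s := - G X - kap * h ^+ 2 * (lam * e s) - eta * (M * expR (M * (s - t1))).
pose E s := - kap * e s.
pose dE s := - kap * (lam * e s).
have EE (s : R) : is_derive s 1 E (dE s).
  by apply: is_deriveZ; exact: is_derive_expR_affine.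
have AE (s : R) : is_derive s 1 A (dA s).
  apply: is_deriveB; last by apply: is_deriveZ; exact: is_derive_expR_affine.
  apply: is_deriveB; last by apply: is_deriveZ; exact: is_derive_expR_affine.
  rewrite -[- G X]add0r; apply: is_deriveB.
  rewrite (_ : (fun s => (s - t0) * G X) = fun s => G X * (s - t0)).
    rewrite -[X in is_derive _ _ _ X]mulr1; apply: is_deriveZ.
    by rewrite -[X in is_derive _ _ _ X]subr0; apply: is_deriveB.
  by apply/funext => u; rewrite mulrC.
have ec : continuous e by exact: expR_affine_cont.
have dEc : continuous dE.
  by move=> s; do 2 (apply: cvgM; first exact: cvg_cst); exact: ec.
have dAc : continuous dA.
  move=> s; apply: cvgB; last first.
    by do 2 (apply: cvgM; first exact: cvg_cst); exact: expR_affine_cont.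
  apply: cvgB; first exact: cvg_cst.
  by do 2 (apply: cvgM; first exact: cvg_cst); exact: ec.
pose phi := bump A E p X x0.
have phiC : C12 phi by exact: bump_C12 AE EE dAc dEc XT.
have phiE s y : phi (s, x0 + y) = c - (s - t0) * G X + quad p X y
    - kap * e s * quartic h y - eta * expR (M * (s - t1)).
  by rewrite /phi /bump /= [x0 + y]addrC addrK /A /E /quartic; ring.
have e1 s : t0 <= s -> 1 <= e s.
  by move=> ts; rewrite -expR0 ler_expR mulr_ge0 ?subr_ge0// ltW.
have phi_far s y : t0 <= s -> s <= t2 ->
    phi (s, x0 + y) <= Cs - Mv - kap / 2 * `|y| ^+ 4 - eta * expR (M * (s - t1)).
  move=> ts st; rewrite phiE lerD2r.
  have H1 : - ((s - t0) * G X) <= `|G X| * t2.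
    rewrite (le_trans (ler_norm _))// normrN normrM mulrC ler_wpM2l// ger0_norm ?subr_ge0//.
    by rewrite (le_trans _ st)// gerBl.
  have H2 := qU y.
  have H3 : kap * `|y| ^+ 4 <= kap * e s * quartic h y.
    rewrite -mulrA ler_pM2l// (@le_trans _ _ (quartic h y))//.
      by rewrite (le_trans (norm4_le y))// lerDl sqr_ge0.
    by rewrite ler_peMl ?quartic_ge0// e1.
  rewrite /Cs; lra.
(* Beyond this radius the remaining quartic exceeds [Cs]; [|y1|] is included so that the point of
   the assumed failure lies in [K]. *)
pose r0 := Num.max `|y1| (1 + `|Cs| * 2 / kap).
have r01 : 1 <= r0.
  by rewrite le_max; apply/orP; right; rewrite lerDl divr_ge0 ?mulr_ge0// ltW.
have r0P (r : R) : r0 < r -> Cs < kap / 2 * r ^+ 4.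
  move=> rr; have r1 : 1 <= r by rewrite (le_trans r01)// ltW.
  have r14 : r <= r ^+ 4 by rewrite -[leLHS]expr1 ler_weXn2l.
  have k2 : 0 < kap / 2 by rewrite divr_gt0.
  apply: (@lt_le_trans _ _ (kap / 2 * r)); last by rewrite ler_pM2l.
  have : kap / 2 * (1 + `|Cs| * 2 / kap) < kap / 2 * r.
    by rewrite ltr_pM2l// (le_lt_trans _ rr)// le_max lexx orbT.
  rewrite (_ : kap / 2 * (1 + _) = kap / 2 + `|Cs|); last by field; rewrite gt_eqF.
  by have := ler_norm Cs; lra.
pose K : set (R * 'rV[R]_N) := `[t0, t2]%classic `*`
  [set x : 'rV[R]_N | forall i, x ord0 i \in `[x0 0 i - r0, x0 0 i + r0]].
have Kc : compact K.
  apply: compact_setX; first exact: segment_compact.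
  apply: (@rV_compact _ _ (fun i => `[x0 0 i - r0, x0 0 i + r0]%classic)) => i.
  exact: segment_compact.
have K1 : K (t1, x0 + y1).
  split => /=; first by rewrite in_itv/= (ltW t01).
  move=> i; rewrite in_itv/= mxE lerD2l lerD2l -ler_norml.
  by rewrite (le_trans (norm_coord _ _ _))// le_max lexx.
have KI : K `<=` cylinder (0 |` I).
  move=> z [] /=; rewrite in_itv/= => /andP[z0 zt] _; rewrite /cylinder/=.
  have [->|zn0] := eqVneq z.1 0; first by left.
  by right; apply: It2 => //; rewrite lt_neqAle eq_sym zn0 (le_trans t00).
have gc : {within K, continuous (fun z => phi z - v z)}.
  move=> z; apply: cvgB.
    by apply: (continuous_subspaceT (f := phi)); case: phiC.
  exact: (continuous_subspaceW KI vc).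
have [z /set_mem Kz zmax] := compact_EVT_max (ex_intro _ _ K1) Kc gc.
have gz0 : 0 < phi z - v z.
  apply: lt_le_trans (zmax _ (mem_set K1)).
  rewrite subr_gt0 phiE subrr mulr0 expR0 mulr1.
  by move: contra; rewrite /e /lam; lra.
have gmax s x : t0 <= s -> s <= t2 -> phi (s, x) - v (s, x) <= phi z - v z.
  move=> ts st.
  have [xK|xK] := pselect (`|x - x0| <= r0).
    apply: zmax; apply: mem_set; split => /=; first by rewrite in_itv/= ts.
    move=> i; rewrite in_itv/= -ler_distl.
    rewrite (_ : _ - _ = (x - x0) 0 i); last by rewrite !mxE.
    exact: le_trans (norm_coord _ _ _) xK.
  apply/ltW/(lt_trans _ gz0).
  move/negP: xK; rewrite -ltNge => /r0P C.
  have := phi_far s (x - x0) ts st; rewrite addrC subrK => F.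
  have := vM s x (le_trans t00 ts) st; rewrite ler_norml => /andP[V _].
  have : 0 < eta * expR (M * (s - t1)) by rewrite mulr_gt0// expR_gt0.
  lra.
case: z Kz zmax gz0 gmax => s x [] /=; rewrite in_itv/= => /andP[ts st] _ _ gz0 gmax.
(* At [t0] the barrier lies below [v] by hypothesis, so the positive maximum is attained later. *)
have ts' : t0 < s.
  rewrite lt_neqAle ts andbT; apply/eqP => E0; move: gz0; rewrite -E0 ltNge => /negP; apply.
  have := v0 (x - x0); have := phiE t0 (x - x0).
  rewrite (_ : x0 + (x - x0) = x); last by rewrite addrC subrK.
  move=> ->; rewrite /e subrr mul0r mulr0 expR0 mulr1 => V.
  have : 0 < eta * expR (M * (t0 - t1)) by rewrite mulr_gt0// expR_gt0.
  lra.
(* By the choice of [M] the maximum is not at [t2], unless [t2] is the last time of [I], where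
   neighbourhoods within the cylinder only look back. *)
have st' : s < t2 \/ forall s, I s -> s <= t2.
  case: t2P => [t12'|]; last by right.
  left; rewrite lt_neqAle st andbT; apply/eqP => E2; move: gz0; rewrite E2 ltNge => /negP; apply.
  have := phi_far t2 (x - x0) (ltW (lt_le_trans t01 t12)) (lexx _).
  rewrite (_ : x0 + (x - x0) = x); last by rewrite addrC subrK.
  have := vM t2 x (ltW t20) (lexx _); rewrite ler_norml => /andP[V _].
  have := MP t12'.
  have : 0 <= kap / 2 * `|x - x0| ^+ 4.
    by rewrite mulr_ge0 ?exprn_ge0// divr_ge0// ltW.
  lra.
have Is : I s by apply: It2 => //; exact: le_lt_trans ts'.
have fstc : (w.1 @[w --> (s, x)] --> s) by exact: cvg_fst.
have nt2 : \forall w \near nbhs (s, x), cylinder I w -> w.1 <= t2.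
  case: st' => [st'|It']; last by apply: nearW => w; exact: It'.
  by near=> w => _; near: w; exact: (cvgr_le s fstc).
have /(vs phi (s, x) phiC Is) : \forall w \near within (cylinder I) (nbhs (s, x)),
    v (s, x) - phi (s, x) <= v w - phi w.
  rewrite near_withinE; near=> w => Iw.
  have w1 : t0 < w.1.
    by near: w; exact: (cvgr_gt s fstc).
  have w2 : w.1 <= t2.
    by move: Iw; near: w; exact: nt2.
  have := gmax w.1 w.2 (ltW w1) w2; rewrite -surjective_pairing; lra.
rewrite (bump_time_derivative p X x0 AE EE) (bump_hessian A E p x0 XT) leNgt => /negP; apply.
rewrite /=; set y := x - x0.
pose d : 'rV[R]_N := \row_i (12 * (kap * e s) * y 0 i ^+ 2).
have es : 0 < e s by exact: expR_gt0.
have -> : X + diag_mx (\row_i (12 * E s * y 0 i ^+ 2)) = X - diag_mx d.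
  rewrite -raddfN; congr (_ + diag_mx _); apply/rowP => i; rewrite !mxE /E; ring.
have d0 i : 0 <= d 0 i.
  by rewrite mxE mulr_ge0 ?sqr_ge0// mulr_ge0// mulr_ge0// ltW.
have G1 := GB X d d0.
have dS : \sum_i d 0 i = 12 * (kap * e s) * \sum_i y 0 i ^+ 2.
  by rewrite mulr_sumr; apply: eq_bigr => i _; rewrite mxE.
(* Diffusion of the penalty uses up [lam - 1 / h] of its growth rate; the remaining [1 / h] and the
   [eta] term contradict the supersolution inequality strictly. *)
have S1 : B * \sum_i d 0 i <= kap * e s * ((lam - 1 / h) * quartic h y).
  rewrite dS (_ : B * _ = kap * e s * (12 * B * \sum_i y 0 i ^+ 2)); last by ring.
  rewrite ler_pM2l ?mulr_gt0//.
  have := sum_sqr_quartic y h0; rewrite -ler_pdivlMl// => S.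
  have B12 : 0 <= 12 * B by rewrite mulr_ge0.
  apply: le_trans (ler_wpM2l B12 S) _.
  rewrite le_eqVlt; apply/orP; left; apply/eqP.
  by rewrite /lam /barrier_rate; field; rewrite gt_eqF.
have : 0 < kap * e s * (1 / h * quartic h y).
  rewrite !mulr_gt0 ?divr_gt0 ?invr_gt0// (lt_le_trans _ (quartic_ge h y))// exprn_gt0//.
have : 0 < eta * (M * expR (M * (s - t1))) by rewrite !mulr_gt0// expR_gt0.
move: G1 S1; rewrite /dA /dE /quartic; lra.
Unshelve. all: by end_near. Qed.

(** * Bellman operators *)

Lemma form_expand (R : realType) (N : nat) (b : 'M[R]_N) (xi : 'rV[R]_N) (t : R) k :
  b^T = b ->
  ((xi + t *: delta_mx 0 k) *m b *m (xi + t *: delta_mx 0 k)^T) 0 0 =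
  (xi *m b *m xi^T) 0 0 + 2 * t * (xi *m b) 0 k + t ^+ 2 * b k k.
Proof.
move=> bT.
have F (x : 'rV[R]_N) : (x *m b *m x^T) 0 0 = \sum_j (x *m b) 0 j * x 0 j.
  by rewrite mxE; apply: eq_bigr => j _; rewrite [_^T _ _]mxE.
have rE j : ((xi + t *: delta_mx 0 k) *m b) 0 j = (xi *m b) 0 j + t * b k j.
  by rewrite mulmxDl -scalemxAl -rowE [LHS]mxE; congr (_ + _); rewrite !mxE.
have xE j : (xi + t *: delta_mx 0 k) 0 j = xi 0 j + t * (j == k)%:R.
  by rewrite !mxE eqxx.
have K : \sum_j b k j * xi 0 j = (xi *m b) 0 k.
  by rewrite mxE; apply: eq_bigr => j _; rewrite -[in LHS]bT mxE mulrC.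
have dE (g : 'I_N -> R) : \sum_j g j * (t * (j == k)%:R) = t * g k.
  rewrite (bigD1 k)//= big1 ?addr0 ?eqxx ?mulr1 1?mulrC// => j /negbTE ->.
  by rewrite !mulr0.
rewrite !F (eq_bigr (fun j => (xi *m b) 0 j * xi 0 j + t * (b k j * xi 0 j) +
    ((xi *m b) 0 j + t * b k j) * (t * (j == k)%:R))); last first.
  move=> j _; rewrite rE xE.
  by ring.
by rewrite !big_split/= dE -mulr_sumr K; ring.
Qed.

Lemma psd_diag (R : realType) (N : nat) (b : 'M[R]_N) k : psdmx b -> 0 <= b k k.
Proof.
move=> [bT bp]; have := bp (delta_mx 0 k).
by rewrite -rowE trmx_delta -colE !mxE.
Qed.

Lemma psd_diag0 (R : realType) (N : nat) (b : 'M[R]_N) k j :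
  psdmx b -> b k k = 0 -> b k j = 0.
Proof.
move=> [bT bp] bk0; apply/eqP/negP => /negP bkj.
have E (t : R) : 0 <= b j j + 2 * t * b j k.
  have := bp (delta_mx 0 j + t *: delta_mx 0 k).
  by rewrite form_expand// bk0 mulr0 addr0 -rowE trmx_delta -colE !mxE.
have bjk : b j k != 0 by rewrite -[b]bT mxE.
(* Here the affine function of [t] in [E] takes the value -1. *)
have := E (- (b j j + 1) / (2 * b j k)).
rewrite (_ : b j j + _ = -1); first by lra.
by field.
Qed.

(** One step of the Cholesky factorization. A zero pivot has a zero row, and nothing is subtracted;
    otherwise the rank-one matrix built from row [k] clears this row and leaves zero rows zero. *)
Lemma psd_deflate (R : realType) (N : nat) (b : 'M[R]_N) k : psdmx b ->
  exists s : 'rV[R]_N, psdmx (b - s^T *m s) /\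
    forall i, i = k \/ (forall j, b i j = 0) -> forall j, (b - s^T *m s) i j = 0.
Proof.
move=> bpsd; have [bT bp] := bpsd.
have bs i j : b i j = b j i by rewrite -[in LHS]bT mxE.
have [bk0|bk0] := eqVneq (b k k) 0.
  exists 0; rewrite mulmx0 subr0; split => // i [->|//] j.
  exact: psd_diag0.
have bkk : 0 < b k k by rewrite lt_neqAle eq_sym bk0 psd_diag.
have ss : (Num.sqrt (b k k))^-1 * (Num.sqrt (b k k))^-1 = (b k k)^-1.
  by rewrite -invfM -expr2 sqr_sqrtr// ltW.
pose s := (Num.sqrt (b k k))^-1 *: row k b.
have s0 j : s 0 j = (Num.sqrt (b k k))^-1 * b k j by rewrite !mxE.
have sE i j : (s^T *m s) i j = b k i * b k j / b k k.
  by rewrite mxE big_ord1 mxE !s0 mulrACA ss mulrC.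
exists s; split; last first.
  move=> i H j; rewrite [LHS]mxE [X in _ + X]mxE sE; case: H => [->|bi].
    by field.
  by rewrite bi bs bi !mul0r subrr.
split; first by rewrite linearB/= trmx_mul trmxK bT.
(* This coefficient minimizes the form along the [k]-th axis, and the minimum is the form of the
   deflated matrix. *)
move=> xi; have := bp (xi + (- (xi *m b) 0 k / b k k) *: delta_mx 0 k).
rewrite form_expand// => H.
rewrite mulmxBr mulmxBl [X in 0 <= X]mxE [X in _ + X]mxE.
have -> : (xi *m (s^T *m s) *m xi^T) 0 0 = ((xi *m b) 0 k) ^+ 2 / b k k.
  rewrite mulmxA -mulmxA mxE big_ord1.
  have -> : (s *m xi^T) 0 0 = (xi *m s^T) 0 0.
    by rewrite -[s *m _]trmxK trmx_mul trmxK mxE.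
  have -> : (xi *m s^T) 0 0 = (Num.sqrt (b k k))^-1 * (xi *m b) 0 k.
    rewrite /s linearZ/= -scalemxAr mxE; congr (_ * _).
    by rewrite !mxE; apply: eq_bigr => j _; rewrite !mxE bs.
  by rewrite -expr2 exprMn [X in X * _ = _]expr2 ss mulrC.
move: H; congr (0 <= _); field; exact: bk0.
Qed.

(** [N] deflations clear all rows. Zero vectors stay in the list, so its length is the same for
    every control. *)
Lemma psd_factor (R : realType) (N : nat) (a : 'M[R]_N) : psdmx a ->
  exists l : seq 'rV[R]_N, size l = N /\ a = \sum_(s <- l) s^T *m s.
Proof.
move=> apsd.
suff H k : (k <= N)%N -> exists l : seq 'rV[R]_N, [/\ size l = k,
    psdmx (a - \sum_(s <- l) s^T *m s) &
    forall i : 'I_N, (i < k)%N -> forall j, (a - \sum_(s <- l) s^T *m s) i j = 0].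
  have [l [ls _ l0]] := H N (leqnn N).
  exists l; split => //; apply/eqP; rewrite -subr_eq0; apply/eqP/matrixP => i j.
  by rewrite l0// mxE.
elim: k => [|k IH] kN.
  by exists [::]; split => //; rewrite big_nil subr0.
have [l [ls lp l0]] := IH (ltnW kN).
have [s [sp s0]] := psd_deflate (Ordinal kN) lp.
exists (s :: l); rewrite big_cons opprD addrCA addrC; split => //=.
  by rewrite ls.
move=> i; rewrite ltnS leq_eqVlt => /orP[/eqP ik|ik]; apply: s0.
  by left; apply: val_inj.
by right; exact: l0.
Qed.

Lemma tr_factor (R : realType) (N : nat) (l : seq 'rV[R]_N) (X : 'M[R]_N) :
  \tr ((\sum_(s <- l) s^T *m s) *m X) = \sum_(s <- l) quad_diag X s.
Proof.
rewrite mulmx_suml raddf_sum/=; apply: eq_bigr => s _.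
rewrite -mulmxA mxtrace_mulC /mxtrace big_ord1 mxE /quad_diag.
rewrite exchange_big/=; apply: eq_bigr => j _.
rewrite mxE mulr_suml; apply: eq_bigr => i _.
by rewrite [_^T _ _]mxE; ring.
Qed.

(** A diagonal entry of [a] is a sum of squares, so a bound on the diffusion matrices bounds the
    steps of the walks. *)
Lemma factor_entry (R : realType) (N : nat) (l : seq 'rV[R]_N) (a : 'M[R]_N) s i :
  a = \sum_(s <- l) s^T *m s -> s \in l -> s 0 i ^+ 2 <= `|a|.
Proof.
move=> aE sl; apply: (@le_trans _ _ (a i i)); last first.
  by rewrite (le_trans (ler_norm _))// norm_coord.
rewrite aE summxE.
have E (t : 'rV[R]_N) : (t^T *m t) i i = t 0 i ^+ 2.
  by rewrite mxE big_ord1 mxE expr2.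
rewrite (big_rem s)//= E lerDl sumr_ge0// => t _.
by rewrite E sqr_ge0.
Qed.

Lemma trace_bound (R : realType) (N : nat) (a X : 'M[R]_N) :
  `|\tr (a *m X)| <= `|a| * \sum_i \sum_j `|X j i|.
Proof.
rewrite /mxtrace (le_trans (ler_norm_sum _ _ _))// mulr_sumr ler_sum// => i _.
rewrite mxE (le_trans (ler_norm_sum _ _ _))// mulr_sumr ler_sum// => j _.
by rewrite normrM ler_wpM2r// norm_coord.
Qed.

Lemma trace_diag (R : realType) (N : nat) (a : 'M[R]_N) (d : 'rV[R]_N) :
  \tr (a *m diag_mx d) = \sum_i a i i * d 0 i.
Proof.
rewrite mul_mx_diag /mxtrace; apply: eq_bigr => i _; by rewrite mxE.
Qed.

Section bellman_facts.
Context (R : realType) (N : nat) (D : Type) (a : D -> 'M[R]_N) (f : D -> R) (M F : R).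
Hypothesis D0 : inhabited D.
Hypothesis aM : forall d, `|a d| <= M.
Hypothesis fF : forall d, `|f d| <= F.

Lemma bellman_ge d X : - \tr (a d *m X) - f d <= bellman a f X.
Proof.
apply: ub_le_sup; last by exists d.
exists (M * (\sum_i \sum_j `|X j i|) + F) => _ [e _ <-].
apply: lerD.
  rewrite (le_trans (ler_norm _))// normrN (le_trans (trace_bound _ _))// ler_wpM2r//.
  by apply: sumr_ge0 => i _; exact: sumr_ge0.
by rewrite (le_trans (ler_norm _))// normrN.
Qed.

Lemma bellman_le X c : (forall d, - \tr (a d *m X) - f d <= c) -> bellman a f X <= c.
Proof.
move=> H; case: D0 => d0; apply: ge_sup; first by exists (- \tr (a d0 *m X) - f d0), d0.
by move=> _ [d _ <-].
Qed.

Lemma bellman_elliptic : elliptic M (bellman a f).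
Proof.
move=> X d d0; apply: bellman_le => e.
rewrite mulmxBr linearB/= trace_diag.
have := bellman_ge e X.
have : \sum_i a e i i * d 0 i <= M * \sum_i d 0 i.
  rewrite mulr_sumr ler_sum// => i _; rewrite ler_wpM2r//.
  by rewrite (le_trans (ler_norm _))// (le_trans (norm_coord _ _ _)).
lra.
Qed.

End bellman_facts.

Lemma elliptic_trace (R : realType) (N : nat) (a : 'M[R]_N) (M c : R) : `|a| <= M ->
  elliptic M (fun X => - \tr (a *m X) + c).
Proof.
move=> aM X d d0; rewrite mulmxBr linearB/= trace_diag.
have : \sum_i a i i * d 0 i <= M * \sum_i d 0 i.
  rewrite mulr_sumr ler_sum// => i _; rewrite ler_wpM2r//.
  by rewrite (le_trans (ler_norm _))// (le_trans (norm_coord _ _ _)).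
lra.
Qed.

Lemma ellipticD (R : realType) (N : nat) (M1 M2 : R) (G1 G2 : 'M[R]_N -> R) :
  elliptic M1 G1 -> elliptic M2 G2 -> elliptic (M1 + M2) (fun X => G1 X + G2 X).
Proof.
by move=> H1 H2 X d d0; have := H1 X d d0; have := H2 X d d0; lra.
Qed.

Lemma C12N (R : realType) (N : nat) (phi : R * 'rV[R]_N -> R) : C12 phi ->
  [/\ C12 (fun z => - phi z),
      forall z, time_derivative (fun z => - phi z) z = - time_derivative phi z
    & forall z, hessian (fun z => - phi z) z = - hessian phi z].
Proof.
move=> [c [td tc] s1 s2].
have cN (g : R * 'rV[R]_N -> R) : continuous g -> continuous (fun z => - g z).
  by move=> gc z; apply: cvgN; exact: gc.
have tE : time_derivative (fun z => - phi z) = fun z => - time_derivative phi z.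
  by apply/funext => z; rewrite /time_derivative deriveN.
have pE i : partial i (fun z => - phi z) = fun z => - partial i phi z.
  by apply/funext => z; rewrite /partial deriveN//; case: (s1 i).
have p2E i j : partial j (partial i (fun z => - phi z)) =
    fun z => - partial j (partial i phi) z.
  rewrite pE; apply/funext => z; rewrite {1}/partial deriveN//; by case: (s2 i j).
split; last by move=> z; apply/matrixP => i j; rewrite !mxE p2E.
- split; first exact: cN.
  + split; last by rewrite tE; exact: cN.
    by move=> z; exact: derivableN.
  + move=> i; have [d1 d2] := s1 i; split; last by rewrite pE; exact: cN.
    by move=> z; exact: derivableN.
  + move=> i j; have [d1 d2] := s2 i j; split; last by rewrite p2E; exact: cN.
    by move=> z; rewrite pE; exact: derivableN.
- by move=> z; rewrite tE.
Qed.

(** Freezing a control lowers the operator, so subsolutions remain subsolutions of the linear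
    equation, and a change of sign makes them supersolutions. Upper bounds thus follow from
    [lower_barrier] too. *)
Lemma visc_subsolutionN (R : realType) (N : nat) (G : 'M[R]_N -> R) (I : set R)
    (a : 'M[R]_N) (c : R) (u : R * 'rV[R]_N -> R) :
  (forall X, - \tr (a *m X) - c <= G X) -> visc_subsolution G I u ->
  visc_supersolution (fun X => - \tr (a *m X) + c) I (fun z => - u z).
Proof.
move=> GE us phi z phiC Iz near_min.
have [C1 C2 C3] := C12N phiC.
have := us _ z C1 Iz; rewrite C2 C3.
have := GE (- hessian phi z); rewrite mulmxN linearN/=.
move=> H1 H2; have : - time_derivative phi z + G (- hessian phi z) <= 0.
  apply: H2; move: near_min; apply: filterS => w; lra.
lra.
Qed.

(** * Error estimates *)

(* What [lower_barrier] says of the values [W], [W'] of a supersolution at the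
   beginning and at the end of a time step [h]; unlike the equation, this composes. *)
Definition super_step (R : realType) (N : nat) (G : 'M[R]_N -> R) (lam h : R)
    (W W' : 'rV[R]_N -> R) :=
  forall x0 c p X kap, X^T = X -> 0 < kap ->
    (forall y, c + quad p X y - kap * quartic h y <= W (x0 + y)) ->
    forall y, c - h * G X + quad p X y - kap * expR lam * quartic h y <= W' (x0 + y).

(** The first step hands over a barrier with the same [p] and [X]; only the constant and the penalty
    change. Both operators are therefore evaluated at the same matrix and their values add up, which
    is the consistency of the splitting. *)
Lemma super_step_comp (R : realType) (N : nat) (G1 G2 : 'M[R]_N -> R) (l1 l2 h : R)
    (W W' W'' : 'rV[R]_N -> R) :
  super_step G1 l1 h W W' -> super_step G2 l2 h W' W'' ->
  super_step (fun X => G1 X + G2 X) (l1 + l2) h W W''.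
Proof.
move=> S1 S2 x0 c p X kap XT k0 H y.
have k1 : 0 < kap * expR l1 by rewrite mulr_gt0// expR_gt0.
have := S2 x0 _ p X _ XT k1 (S1 x0 c p X kap XT k0 H) y.
by rewrite expRD; congr (_ <= _); ring.
Qed.

(** Since [k / h] is [1 / m.+1], the growth compounded over [m.+1] rounds stays below an exponential
    that does not depend on [m]. *)
Lemma walk_growth (R : realType) (N : nat) (B k h : R) (m n0 : nat) (l : seq 'rV[R]_N) :
  0 <= B -> 0 < k -> h = m.+1%:R * k -> (size l <= n0)%N ->
  (1 + walk_rate N B * (k / h)) ^+ size (rep m.+1 l) <= expR (walk_rate N B * n0%:R).
Proof.
move=> B0 k0 hE ln.
have w0 := walk_rate_ge0 N B0.
have E : k / h = m.+1%:R^-1.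
  by rewrite hE invfM mulrCA mulfV ?mulr1 ?gt_eqF.
have m0 : 0 <= m.+1%:R^-1 :> R by rewrite invr_ge0.
rewrite E size_rep; apply: (@le_trans _ _ (expR (walk_rate N B * m.+1%:R^-1) ^+ (m.+1 * size l))).
  by rewrite lerXn2r ?nnegrE ?expR_ge0 ?expR_ge1Dx// addr_ge0// mulr_ge0.
rewrite -expRM_natr ler_expR natrM mulrA.
rewrite -[walk_rate N B * _ * _]mulrA mulVf ?pnatr_eq0// mulr1.
by rewrite ler_wpM2l// ler_nat.
Qed.

(** The first term pays for the mollification, the second for the Taylor remainder, with the growth
    factors of the penalty under the solution and under the walk. Taking [L + 1] keeps the penalty
    positive when [L = 0]. *)
Definition error_cst (R : realType) (N n0 : nat) (B lam L : R) : R :=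
  4 * N%:R * (L + 1) +
  4 * N.+1%:R ^+ 3 * (L + 1) * (expR lam + expR (walk_rate N B * n0%:R)).

Lemma error_cst_ge0 (R : realType) (N n0 : nat) (B lam L : R) : 0 <= L ->
  0 <= error_cst N n0 B lam L.
Proof.
move=> L0; have L1 : 0 <= L + 1 by rewrite addr_ge0.
by rewrite addr_ge0// !mulr_ge0// ?exprn_ge0// addr_ge0// expR_ge0.
Qed.

(* The choice [eps = h^(1/6)] balances the error [L eps] of the regularization
   with the consistency error [L h^(1/2) / eps^2] per unit of time. *)
Lemma sqrt_powR6 (R : realType) (h : R) : 0 < h ->
  Num.sqrt h / (h `^ (1 / 6)) ^+ 2 = h `^ (1 / 6).
Proof.
move=> h0; have e0 : 0 < h `^ (1 / 6) by exact: powR_gt0.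
rewrite -powR12_sqrt ?ltW//; apply: (@mulIf _ ((h `^ (1 / 6)) ^+ 2)).
  by rewrite gt_eqF// exprn_gt0.
rewrite divfK ?gt_eqF ?exprn_gt0// -exprS -powR_mulrn ?ltW// -powRrM.
by congr (_ `^ _); lra.
Qed.

(** Induction on the mollified iterates. The Taylor polynomial at [x], minus the penalty, is a
    barrier below [W j] and bounds [W j.+1 x] from below; plus the penalty, it lies above the
    mollified iterate and bounds the next one at [x] from above. Both bounds contain the same
    [h * G X], which cancels. *)
Lemma lower_iterate (R : realType) (N : nat) (D : Type) (s : D -> seq 'rV[R]_N)
    (f : D -> R) (B F L lam k h b : R) (m n0 n : nat) (G : 'M[R]_N -> R)
    (W : nat -> 'rV[R]_N -> R) (V : 'rV[R]_N -> R) :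
  inhabited D -> 0 <= B -> 0 <= L -> 0 < k -> h = m.+1%:R * k ->
  (forall d t i, t \in s d -> t 0 i ^+ 2 <= B) -> (forall d, size (s d) <= n0)%N ->
  (forall d, `|f d| <= F) ->
  (forall X c, (forall d, - \sum_(t <- s d) quad_diag X t - f d <= c) -> G X <= c) ->
  (forall j, (j < n)%N -> super_step G lam h (W j) (W j.+1)) ->
  lip L V -> (forall x, `|V x| <= b) -> (forall x, V x <= W 0%N x) ->
  forall j, (j <= n)%N -> forall x,
    iter j (policy k m.+1 s f) V x <=
    W j x + error_cst N n0 B lam L * (1 + j%:R * h) * h `^ (1 / 6).
Proof.
move=> D0 B0 L0 k0 hE sB sn fF GX Wstep VL Vb VW.
have h0 : 0 < h by rewrite hE mulr_gt0.
pose P := policy k m.+1 s f.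
have PV := policy_iter m.+1 s D0 (ltW k0) fF Vb VL.
pose eps := h `^ (1 / 6).
have e0 : 0 < eps by exact: powR_gt0.
have rh : 0 < Num.sqrt h by rewrite sqrtr_gt0.
pose C3 := 4 * N.+1%:R ^+ 3 * (L + 1).
have C30 : 0 < C3 by rewrite !mulr_gt0// ?exprn_gt0// ltr_wpDl.
(* Chosen so that [cube_quartic] bounds the cubic Taylor remainder by [kap * quartic h y]. *)
pose kap := C3 / eps ^+ 2 / Num.sqrt h.
have kap0 : 0 < kap by rewrite !divr_gt0// exprn_gt0.
pose Q := expR lam + expR (walk_rate N B * n0%:R).
have taylor j x : exists (p : 'rV[R]_N) (X : 'M[R]_N), X^T = X /\
    forall y, `|molr eps (iter j P V) (x + y) - (molr eps (iter j P V) x + quad p X y)| <=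
      kap * quartic h y.
  have [p [X [XT H]]] := molr_taylor x e0 L0 (PV j).1.
  exists p, X; split => // y; apply: (le_trans (H y)).
  have C := cube_quartic y h0.
  apply: (@le_trans _ _ (kap * (Num.sqrt h * `|y| ^+ 3))); last by rewrite ler_pM2l.
  rewrite [leRHS]mulrA /kap divfK ?gt_eqF// ler_wpM2r ?exprn_ge0// ler_wpM2r ?invr_ge0 ?sqr_ge0//.
  by rewrite /C3 ler_wpM2l ?mulr_ge0 ?exprn_ge0// lerDl.
have close j x : `|molr eps (iter j P V) x - iter j P V x| <= N%:R * (2 * L * eps).
  have := mol_close (enum 'I_N) e0 (@norm_delta R N) L0 (PV j).1 x.
  by rewrite size_enum_ord.
have main j : (j <= n)%N -> forall x,
    molr eps (iter j P V) x <= W j x + N%:R * (2 * L * eps) + j%:R * (kap * Q * h ^+ 2).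
  elim: j => [|j IH] jn x.
    rewrite mul0r addr0; have := close 0%N x; rewrite ler_norml => /andP[_].
    by rewrite /=; have := VW x; lra.
  have [p [X [XT H]]] := taylor j x.
  set c0 := N%:R * (2 * L * eps) + j%:R * (kap * Q * h ^+ 2).
  pose w := molr eps (iter j P V).
  have Wlow y : (w x - c0) + quad p X y - kap * quartic h y <= W j (x + y).
    have := IH (ltnW jn) (x + y); rewrite -/w -addrA -/c0.
    have := H y; rewrite -/w ler_norml => /andP[]; lra.
  (* Only the centre [y = 0] of the barrier is used, where the quartic is [h^2]. *)
  have := Wstep j jn x (w x - c0) p X kap XT kap0 Wlow 0.
  rewrite addr0 quad0 addr0 => S1.
  have q0 : quartic h (0 : 'rV[R]_N) = h ^+ 2.
    by rewrite /quartic big1 ?add0r// => i _; rewrite mxE expr0n.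
  have S2 : h * G X <= w x - molr eps (iter j.+1 P V) x
      + kap * expR (walk_rate N B * n0%:R) * h ^+ 2.
    rewrite -ler_pdivlMl//; apply: GX => d.
    rewrite ler_pdivlMl//.
    have [bj Vbj] := (PV j).2.
    have islj : islip (iter j P V) by exists L; exact: (PV j).1.
    have islw : islip (walk k (rep m.+1 (s d)) (iter j P V)).
      by exists L; apply: walk_lip; exact: (PV j).1.
    (* The new iterate lies below the walk of every single control, and mollification preserves
       order and commutes with the walk. *)
    have M1 : molr eps (iter j.+1 P V) x <= walk k (rep m.+1 (s d)) w x + h * f d.
      rewrite /w -molr_walk//.
      have -> : molr eps (walk k (rep m.+1 (s d)) (iter j P V)) x + h * f d =
          molr eps (fun z => walk k (rep m.+1 (s d)) (iter j P V) z + h * f d) x.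
        have Ml : linop (@molr R N eps) by exact: mol_linop.
        rewrite (linopD Ml islw (islip_cst _ _)).
        by rewrite [in RHS]/molr mol_cst.
      apply: mol_le => //.
      - by exists L; exact: (PV j.+1).1.
      - by apply: islip_add => //; exact: islip_cst.
      - by move=> z; rewrite hE; exact: policy_le (ltW k0) fF Vbj.
    have touch y : w (x + y) <= w x + quad p X y + kap * quartic h y.
      by have := H y; rewrite -/w ler_norml => /andP[_]; lra.
    have kh : k <= h by rewrite hE ler_peMl ?ler1n ?(ltW k0).
    have sB' t i : t \in rep m.+1 (s d) -> t 0 i ^+ 2 <= B.
      by move=> /mem_rep; exact: sB.
    have := walk_touch h0 (ltW k0) kh B0 sB' (ltW kap0) touch 0.
    rewrite addr0 quad0 addr0 q0 sum_rep => M2.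
    have g := walk_growth B0 k0 hE (sn d).
    have : kap * (1 + walk_rate N B * (k / h)) ^+ size (rep m.+1 (s d)) * h ^+ 2 <=
        kap * expR (walk_rate N B * n0%:R) * h ^+ 2.
      by rewrite ler_wpM2r ?sqr_ge0// ler_pM2l.
    have Kh : k * (m.+1%:R * \sum_(t <- s d) quad_diag X t) = h * \sum_(t <- s d) quad_diag X t.
      by rewrite mulrA [k * _]mulrC -hE.
    move: M2; rewrite Kh; lra.
  move: S1; rewrite q0 -[j.+1%:R]natr1 /c0 /Q; lra.
move=> j jn x.
have := main j jn x; have := close j x; rewrite ler_norml => /andP[C1 _] M1.
(* For [eps = h^(1/6)] the loss per step is of order [h * eps], hence [j h eps] after [j] steps. *)
have Eps : kap * h ^+ 2 = C3 * h * eps.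
  have := sqrt_powR6 h0; rewrite -/eps => E6; rewrite -[in RHS]E6 /kap.
  move: rh (sqr_sqrtr (ltW h0)); move: (Num.sqrt h) => r r0 <-.
  by field; rewrite !gt_eqF.
rewrite -/eps (_ : error_cst N n0 B lam L = 4 * N%:R * (L + 1) + C3 * Q)//.
have T1 : 0 <= N%:R * eps by rewrite mulr_ge0// ltW.
have T2 : 0 <= N%:R * (L + 1) * (j%:R * h) * eps.
  have L1 : 0 <= L + 1 by rewrite addr_ge0.
  by apply: mulr_ge0; [rewrite !mulr_ge0// ltW|exact: ltW].
have T3 : 0 <= C3 * Q * eps.
  by apply/ltW; do 2 (apply: mulr_gt0 => //); apply: addr_gt0; exact: expR_gt0.
have E : j%:R * (kap * Q * h ^+ 2) = C3 * Q * (j%:R * h) * eps.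
  by rewrite mulrAC Eps; ring.
rewrite E in M1; lra.
Qed.

(** * Frozen controls and convergence of the value iteration *)

Definition gram (R : realType) (N : nat) (l : seq 'rV[R]_N) : 'M[R]_N :=
  \sum_(s <- l) s^T *m s.

Lemma lip_normE (R : realType) (V : normedModType R) (f : V -> R) :
  [lipschitz f x | x in setT] <-> exists2 L, 0 <= L & lip L f.
Proof.
split=> [[M [_ H]]|[L L0 fL]].
  exists (`|M| + 1); first by rewrite addr_ge0.
  move=> x y; have := H (`|M| + 1) _ (x, y); apply => //.
  by rewrite (le_lt_trans (ler_norm _))// ltrDl.
exists L; split; first exact: ger0_real.
move=> K LK [x y] _ /=; rewrite (le_trans (fL x y))// ler_wpM2r//.
exact: ltW.
Qed.

Lemma boundedE (R : realType) (T : Type) (V : normedModType R) (f : T -> V) :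
  [bounded f x | x in setT] <-> exists M, forall x, `|f x| <= M.
Proof.
split=> [[M [_ H]]|[M fM]].
  by exists (M + 1) => x; apply: (H (M + 1)) => //; rewrite ltrDl.
exists (Num.max 0 M); split; first by rewrite ger0_real// le_max lexx.
move=> K MK x _; apply: (le_trans (fM x)); rewrite ltW// (le_lt_trans _ MK)//.
by rewrite le_max lexx orbT.
Qed.

Lemma horizonW (R : realType) (I : set R) (t r : R) :
  horizon I t -> 0 < r -> r <= t -> horizon I r.
Proof.
move=> [[t' tt' It]|[It It']] r0; rewrite le_eqVlt => /predU1P[->|rt].
- by left; exists t'.
- by left; exists t' => //; exact: lt_trans tt'.
- by right.
- by left; exists t.
Qed.

Lemma upper_iterate (R : realType) (N : nat) (l : seq 'rV[R]_N) (f0 B L lam k b : R)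
    (m n0 : nat) (U : nat -> 'rV[R]_N -> R) (V : 'rV[R]_N -> R) :
  0 <= B -> 0 <= L -> 0 < k ->
  (forall t i, t \in l -> t 0 i ^+ 2 <= B) -> (size l <= n0)%N ->
  (forall j, (j < m)%N -> super_step (fun X => - \tr (gram l *m X) + f0) lam k
     (fun x => - U j x) (fun x => - U j.+1 x)) ->
  lip L V -> (forall x, `|V x| <= b) -> (forall x, U 0%N x <= V x) ->
  forall x, U m x <= walk k (rep m l) V x + m%:R * k * f0
    + error_cst N n0 B lam L * (1 + m%:R * k) * k `^ (1 / 6).
Proof.
move=> B0 L0 k0 lB ln step VL Vb UV x.
have NVL : lip L (fun x => - V x).
  by move=> y z; rewrite -opprD normrN.
have NVb y : `|- V y| <= b by rewrite normrN.
have NUV y : - V y <= - U 0%N y by rewrite lerN2.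
have kE : k = 1%:R * k by rewrite mul1r.
have GX (X : 'M[R]_N) (c : R) :
  (forall _ : unit, - \sum_(t <- l) quad_diag X t - - f0 <= c) ->
  - \tr (gram l *m X) + f0 <= c.
  by move=> /(_ tt); rewrite tr_factor opprK.
(* With a single control and one round per time step (the argument 0 stands for [m], of which the
   successor is used) the value iteration is the walk itself. Functions and cost change sign. *)
have := @lower_iterate _ _ unit (fun=> l) (fun=> - f0) B `|f0| L lam k k b 0 n0 m
  _ (fun j x => - U j x) (fun x => - V x) (inhabits tt) B0 L0 k0 kE (fun _ => lB)
  (fun _ => ln) (fun _ => _) GX step NVL NVb NUV m (leqnn m) x.
rewrite normrN => /(_ (fun=> lexx _)).
suff -> : iter m (policy k 1 (fun _ : unit => l) (fun=> - f0)) (fun x => - V x) x =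
  - (walk k (rep m l) V x + m%:R * k * f0) by lra.
elim: m {step} x => [|m IH] x; first by rewrite !mul0r addr0.
rewrite iterS (_ : iter m _ _ = fun x => - (walk k (rep m l) V x + m%:R * k * f0)); last first.
  by apply/funext => y; rewrite IH.
have pE W b' : (forall x, `|W x| <= b') ->
    policy k 1 (fun _ : unit => l) (fun=> - f0) W x = walk k l W x - k * f0.
  move=> Wb; have E : walk k (rep 1 l) W x + 1%:R * k * - f0 = walk k l W x - k * f0.
    by rewrite mul1r mulrN /rep/= cats0.
  rewrite -E; apply/eqP; rewrite eq_le; apply/andP; split.
    apply: (@policy_le _ _ unit _ b' `|f0| _ (fun=> l) (fun=> - f0) W tt); first exact: ltW.
      by move=> _; rewrite normrN.
    exact: Wb.
  by apply: policy_ge => // _.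
rewrite (pE _ (b + `|m%:R * k * f0|)); last first.
  move=> y; rewrite normrN (le_trans (ler_normD _ _))// lerD2r.
  exact: walk_bound.
rewrite walkN walk_cst repS walk_cat -natr1; ring.
Qed.

(* [G] is the Bellman operator with diffusion matrices [gram (s d)] and costs [f d]. *)
Definition controls (R : realType) (N : nat) (D : Type) (s : D -> seq 'rV[R]_N)
    (f : D -> R) (B F : R) (n0 : nat) (G : 'M[R]_N -> R) :=
  [/\ inhabited D, 0 <= B, forall d, `|gram (s d)| <= B /\ (size (s d) <= n0)%N,
      forall d, `|f d| <= F
    & elliptic B G /\ forall X,
      (forall d, - \tr (gram (s d) *m X) - f d <= G X) /\
      (forall c, (forall d, - \tr (gram (s d) *m X) - f d <= c) -> G X <= c)].

Lemma bellman_controls (R : realType) (N : nat) (D : Type) (a : D -> 'M[R]_N) (f : D -> R) :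
  inhabited D -> (forall d, psdmx (a d)) ->
  [bounded a d | d in setT] -> [bounded f d | d in setT] ->
  exists (s : D -> seq 'rV[R]_N) (B F : R), controls s f B F N (bellman a f).
Proof.
move=> D0 apsd /boundedE[B aB] /boundedE[F fF].
have /choice[s sE] : forall d, exists l : seq 'rV[R]_N,
    size l = N /\ a d = \sum_(s <- l) s^T *m s.
  by move=> d; exact: psd_factor.
have aE d : gram (s d) = a d by rewrite (sE d).2.
exists s, B, F; split => //.
- by case: D0 => d; rewrite (le_trans _ (aB d)).
- by move=> d; rewrite aE (sE d).1.
- split; first exact: bellman_elliptic fF.
  move=> X; split => [d|c H].
    by rewrite aE; exact: (bellman_ge aB fF d X).
  by apply: bellman_le => // d; rewrite -aE.
Qed.

(** A sum of suprema over independent controls is a supremum over pairs, and concatenating step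
    lists adds diffusion matrices. *)
Lemma controls_prod (R : realType) (N : nat) (D1 D2 : Type) s1 s2 f1 f2 (B1 B2 F1 F2 : R)
    (n1 n2 : nat) (G1 G2 : 'M[R]_N -> R) :
  @controls R N D1 s1 f1 B1 F1 n1 G1 -> @controls R N D2 s2 f2 B2 F2 n2 G2 ->
  controls (fun d : D1 * D2 => s1 d.1 ++ s2 d.2) (fun d => f1 d.1 + f2 d.2)
    (B1 + B2) (F1 + F2) (n1 + n2) (fun X => G1 X + G2 X).
Proof.
move=> [[d1] B10 sB1 fF1 [e1 GX1]] [[d2] B20 sB2 fF2 [e2 GX2]].
have gE d : gram (s1 d.1 ++ s2 d.2) = gram (s1 d.1) + gram (s2 d.2).
  by rewrite /gram big_cat.
split.
- by exists; exact: (d1, d2).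
- exact: addr_ge0.
- move=> d; have [H1 H2] := sB1 d.1; have [H3 H4] := sB2 d.2.
  by rewrite gE size_cat leq_add// (le_trans (ler_normD _ _))// lerD.
- by move=> d; rewrite (le_trans (ler_normD _ _))// lerD.
- split; first exact: ellipticD.
  move=> X; split=> [d|c H].
    rewrite gE mulmxDl linearD/=.
    by have := (GX1 X).1 d.1; have := (GX2 X).1 d.2; lra.
  rewrite -lerBrDr; apply: (GX1 X).2 => e1'.
  rewrite lerBrDr -lerBrDl; apply: (GX2 X).2 => e2'.
  by have := H (e1', e2'); rewrite gE mulmxDl linearD/=; lra.
Qed.

Lemma controls_entry (R : realType) (N : nat) (D : Type) s f (B F : R) n0 G :
  @controls R N D s f B F n0 G ->
  forall d t i, t \in s d -> t 0 i ^+ 2 <= B.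
Proof.
move=> [_ _ sB _ _] d t i ts.
exact: (le_trans (factor_entry i erefl ts) (sB d).1).
Qed.

(** The rate [barrier_rate / h] acts during the time [h], so the penalty grows by a factor that does
    not depend on [h]. *)
Lemma solution_super_step (R : realType) (N : nat) (B h t : R) (G : 'M[R]_N -> R)
    (I : set R) phi (u : R * 'rV[R]_N -> R) :
  0 <= B -> elliptic B G -> bounded_visc_solution G I phi u ->
  0 < h -> 0 <= t -> horizon I (t + h) ->
  super_step G (barrier_rate N B) h (fun x => u (t, x)) (fun x => u (t + h, x)).
Proof.
move=> B0 GB [uc ub _ _ us] h0 t0 It x0 c p X kap XT kap0 H y.
have tth : t < t + h by rewrite ltrDl.
have := lower_barrier B0 GB h0 kap0 XT uc ub us It t0 tth H y.
by rewrite (addrC t) addrK divfK// gt_eqF.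
Qed.

Lemma solutionN_super_step (R : realType) (N : nat) (a : 'M[R]_N) (f0 B h t : R)
    (G : 'M[R]_N -> R) (I : set R) phi (u : R * 'rV[R]_N -> R) :
  `|a| <= B -> (forall X, - \tr (a *m X) - f0 <= G X) ->
  bounded_visc_solution G I phi u ->
  0 < h -> 0 <= t -> horizon I (t + h) ->
  super_step (fun X => - \tr (a *m X) + f0) (barrier_rate N B) h
    (fun x => - u (t, x)) (fun x => - u (t + h, x)).
Proof.
move=> aB GX [uc ub _ us _] h0 t0 It x0 c p X kap XT kap0 H y.
have tth : t < t + h by rewrite ltrDl.
have B0 : 0 <= B by exact: le_trans aB.
have Nc : {within cylinder (0 |` I), continuous (fun z => - u z)}.
  by move=> z; apply: cvgN; exact: uc.
have Nb tau : I tau -> [bounded - u z | z in cylinder `[0, tau]].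
  move=> /ub[M [Mr HM]]; exists M; split => // K MK z Kz.
  by rewrite /= normrN; exact: (HM K).
have := lower_barrier B0 (elliptic_trace f0 aB) h0 kap0 XT Nc Nb
  (visc_subsolutionN GX us) It t0 tth H y.
by rewrite (addrC t) addrK divfK// gt_eqF.
Qed.

Definition walk_error (R : realType) (N n0 : nat) (B L h k : R) : R :=
  error_cst N n0 B (barrier_rate N B) L * (1 + h) * k `^ (1 / 6).

(** The control [d] is frozen for the whole step [h], and the linear equation is followed in
    substeps [k]. The error vanishes with [k] for fixed [h]; [c] carries the error of earlier
    steps. *)
Lemma solution_le_walk (R : realType) (N : nat) (D : Type) s f (B F L h k t b c : R)
    (n0 m : nat) (G : 'M[R]_N -> R) (I : set R) phi (u : R * 'rV[R]_N -> R) V :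
  @controls R N D s f B F n0 G -> bounded_visc_solution G I phi u ->
  0 <= L -> 0 < k -> h = m.+1%:R * k -> 0 <= t -> horizon I (t + h) ->
  lip L V -> (forall x, `|V x| <= b) -> (forall x, u (t, x) <= V x + c) ->
  forall d x, u (t + h, x) <= walk k (rep m.+1 (s d)) V x + h * f d + c +
    walk_error N n0 B L h k.
Proof.
move=> ctl sol L0 k0 hE t0 It VL Vb uV d x.
have sB := controls_entry ctl.
have [_ B0 sn _ [_ GX]] := ctl.
have VcL : lip L (fun x => V x + c).
  by move=> y z; rewrite opprD addrACA subrr addr0; exact: VL.
have Vcb y : `|V y + c| <= b + `|c| by rewrite (le_trans (ler_normD _ _))// lerD2r.
have step j : (j < m.+1)%N -> super_step (fun X => - \tr (gram (s d) *m X) + f d)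
    (barrier_rate N B) k (fun x => - u (t + j%:R * k, x)) (fun x => - u (t + j.+1%:R * k, x)).
  move=> jm; rewrite -natr1 mulrDl mul1r addrA.
  have jk : 0 <= j%:R * k by rewrite mulr_ge0// ltW.
  apply: (solutionN_super_step (sn d).1 (fun X => (GX X).1 d) sol k0).
    exact: addr_ge0.
  apply: (horizonW It); first by rewrite -addrA ltr_wpDl// ltr_wpDl.
  rewrite -addrA lerD2l hE -[X in _ + X]mul1r -mulrDl ler_pM2r// natr1 ler_nat //.
have := upper_iterate (U := fun j x => u (t + j%:R * k, x)) B0 L0 k0 (sB d) (sn d).2 step VcL Vcb.
rewrite mul0r addr0 => /(_ uV x).
by rewrite walk_cst -hE /walk_error; lra.
Qed.

(** The upper bound adds one [walk_error] per step and passes to the infimum over frozen controls.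
    The lower bound is [lower_iterate]; its error has the shape of [walk_error] with elapsed time
    [j h] and step [h]. *)
Lemma solution_policy (R : realType) (N : nat) (D : Type) s f (B F L h k b : R)
    (n0 m n : nat) (G : 'M[R]_N -> R) (I : set R) phi (u : R * 'rV[R]_N -> R) :
  @controls R N D s f B F n0 G -> bounded_visc_solution G I phi u ->
  0 <= L -> 0 < k -> h = m.+1%:R * k -> (0 < n)%N -> horizon I (n%:R * h) ->
  lip L phi -> (forall x, `|phi x| <= b) ->
  forall j, (j <= n)%N -> forall x,
    let V := iter j (policy k m.+1 s f) phi x in
    u (j%:R * h, x) <= V + j%:R * walk_error N n0 B L h k /\
    V <= u (j%:R * h, x) + walk_error N n0 B L (j%:R * h) h.
Proof.
move=> ctl sol L0 k0 hE n0' It phiL phib j jn x V; rewrite {}/V.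
have h0 : 0 < h by rewrite hE mulr_gt0.
have [D0 B0 sn fF [GB GX]] := ctl.
have hor i : (i < n)%N -> horizon I (i%:R * h + h).
  move=> ii; rewrite -[X in _ + X]mul1r -mulrDl natr1.
  by apply: (horizonW It); [rewrite mulr_gt0|rewrite ler_pM2r// ler_nat].
have u0 y : u (0, y) = phi y by case: sol.
split.
  elim: j jn x => [|j IH] jn x; first by rewrite !mul0r addr0 u0.
  have [VL [b' Vb]] := policy_iter m.+1 s D0 (ltW k0) fF phib phiL j.
  have jh : 0 <= j%:R * h by rewrite mulr_ge0// ltW.
  have := solution_le_walk ctl sol L0 k0 hE jh (hor j jn) VL Vb (IH (ltnW jn)).
  rewrite -[X in _ + X]mul1r -mulrDl natr1 => H.
  rewrite -[j.+1%:R * walk_error _ _ _ _ _ _](_ : j%:R * walk_error N n0 B L h k + walk_error N n0 B L h k = _); last first.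
    by rewrite -natr1 mulrDl mul1r.
  rewrite addrA -!lerBlDr iterS; apply: policy_ge => // d.
  by have := H d x; rewrite -hE; lra.
have step i : (i < n)%N -> super_step G (barrier_rate N B) h
    (fun x => u (i%:R * h, x)) (fun x => u (i.+1%:R * h, x)).
  move=> ii; rewrite -natr1 mulrDl mul1r.
  apply: (solution_super_step B0 GB sol h0); last exact: hor.
  by rewrite mulr_ge0// ltW.
have GX' (X : 'M[R]_N) (c : R) :
    (forall d, - \sum_(t <- s d) quad_diag X t - f d <= c) -> G X <= c.
  by move=> H; apply: (GX X).2 => d; rewrite tr_factor.
apply: (lower_iterate (W := fun i x => u (i%:R * h, x)) D0 B0 L0 k0 hE
  (controls_entry ctl) (fun d => (sn d).2) fF GX' step phiL phib _ jn).
by move=> y; rewrite mul0r u0.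
Qed.

Lemma small_step (R : realType) (C t e : R) : 0 <= C -> 0 < t -> 0 < e ->
  exists n : nat, C * (t / n.+1%:R) `^ (1 / 6) <= e.
Proof.
move=> C0 t0 e0; pose d := e / (C + 1).
have C1 : 0 < C + 1 by rewrite ltr_wpDl.
have d0 : 0 < d by rewrite divr_gt0.
(* The successor of this integer exceeds [t / d^6], so that [t / n.+1 <= d^6]. *)
exists (Num.truncn (t / d ^+ 6)).
set n := Num.truncn _.
have nP : t / n.+1%:R <= d ^+ 6.
  rewrite ler_pdivrMr// mulrC -ler_pdivrMr ?exprn_gt0//.
  by apply: ltW; exact: truncnS_gt.
have : (t / n.+1%:R) `^ (1 / 6) <= d.
  have -> : d = (d ^+ 6) `^ (1 / 6).
    rewrite -powR_mulrn ?ltW// -powRrM (_ : 6%:R * (1 / 6) = 1) ?powRr1 ?ltW//.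
    by lra.
  by rewrite ge0_ler_powR// ?nnegrE ?exprn_ge0 ?divr_ge0// ltW.
move=> H; apply: (le_trans (ler_wpM2l C0 H)).
rewrite /d mulrA ler_pdivrMr// mulrC ler_pM2l//.
by rewrite lerDl.
Qed.

Lemma horizon_infty (R : realType) (t : R) : horizon `]0, +oo[ t.
Proof.
by left; exists (t + 1); rewrite ?ltrDl// => s s0 _; rewrite /= in_itv/= s0.
Qed.

(** The solution is a uniform limit of iterates of [policy], all of which have the constant [L].
    This replaces a comparison principle. *)
Lemma solution_lip (R : realType) (N : nat) (D : Type) s f (B F L b t : R)
    (n0 : nat) (G : 'M[R]_N -> R) phi (u : R * 'rV[R]_N -> R) :
  @controls R N D s f B F n0 G -> bounded_visc_solution G `]0, +oo[ phi u ->
  0 <= L -> 0 < t -> lip L phi -> (forall x, `|phi x| <= b) ->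
  lip L (fun x => u (t, x)).
Proof.
move=> ctl sol L0 t0 phiL phib x y; apply/ler_addgt0Pr => e e0.
have e4 : 0 < e / 4 by rewrite divr_gt0.
have [n nP] := small_step (C := error_cst N n0 B (barrier_rate N B) L * (1 + t))
  (mulr_ge0 (error_cst_ge0 N n0 B _ L0) (addr_ge0 ler01 (ltW t0))) t0 e4.
pose h := t / n.+1%:R; have h0 : 0 < h by rewrite divr_gt0.
have nh : n.+1%:R * h = t by rewrite mulrC divfK ?pnatr_eq0.
have [m mP] := small_step (C := n.+1%:R * (error_cst N n0 B (barrier_rate N B) L * (1 + h)))
  (mulr_ge0 (ler0n _ _) (mulr_ge0 (error_cst_ge0 N n0 B _ L0) (addr_ge0 ler01 (ltW h0)))) h0 e4.
pose k := h / m.+1%:R; have k0 : 0 < k by rewrite divr_gt0.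
have mk : h = m.+1%:R * k by rewrite mulrC divfK ?pnatr_eq0.
have H := solution_policy ctl sol L0 k0 mk (ltn0Sn n) (horizon_infty _) phiL phib (leqnn _).
rewrite nh in H.
have [D0 _ _ fF _] := ctl.
have [VL _] := policy_iter m.+1 s D0 (ltW k0) fF phib phiL n.+1.
have {}H z : `|u (t, z) - iter n.+1 (policy k m.+1 s f) phi z| <= e / 4.
  have [H1 H2] := H z; rewrite ler_distl; apply/andP; split.
    by move: H2 nP; rewrite /walk_error /h; lra.
  by move: H1 mP; rewrite /walk_error /k mulrA; lra.
have := H x; have := H y; have := VL x y.
rewrite !ler_norml => /andP[V1 V2] /andP[H1 H2] /andP[H3 H4].
by apply/andP; split; lra.
Qed.

Lemma solution_bounded (R : realType) (N : nat) (G : 'M[R]_N -> R) (t : R)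
    phi (u : R * 'rV[R]_N -> R) :
  bounded_visc_solution G `]0, +oo[ phi u -> 0 < t ->
  exists M, forall x, `|u (t, x)| <= M.
Proof.
move=> [_ ub _ _ _] t0; have [|M [_ HM]] := ub t; first by rewrite /= in_itv/= t0.
exists (M + 1) => x; apply: (HM (M + 1)); first by rewrite ltrDl.
by rewrite /cylinder/= in_itv/= lexx ltW.
Qed.

(** * The splitting scheme *)

Section splitting_scheme.
Context (R : realType) (N : nat) (D : Type).
Context (s1 s2 : D -> seq 'rV[R]_N) (f1 f2 : D -> R) (B1 B2 F1 F2 : R) (n1 n2 : nat).
Context (G1 G2 : 'M[R]_N -> R) (S1 S2 : R -> ('rV[R]_N -> R) -> 'rV[R]_N -> R).
Hypothesis ctl1 : controls s1 f1 B1 F1 n1 G1.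
Hypothesis ctl2 : controls s2 f2 B2 F2 n2 G2.
Hypothesis sol1 : solution_operator G1 S1.
Hypothesis sol2 : solution_operator G2 S2.
Context (u0 : 'rV[R]_N -> R) (L b h : R).
Hypothesis L0 : 0 <= L.
Hypothesis u0L : lip L u0.
Hypothesis u0b : forall x, `|u0 x| <= b.
Hypothesis h0 : 0 < h.

Let U := splitting S1 S2 h u0.

Lemma solution_operatorP (G : 'M[R]_N -> R) S (phi : 'rV[R]_N -> R) (c : R) :
  solution_operator G S -> lip L phi ->
  (forall x, `|phi x| <= c) ->
  bounded_visc_solution G `]0, +oo[ phi (fun z => S z.1 phi z.2).
Proof.
move=> sol phiL phib; apply: sol; first by apply/boundedE; exists c.
by apply/lip_normE; exists L.
Qed.

Lemma splitting_regular j : (lip L (U j) /\ exists c, forall x, `|U j x| <= c) /\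
  (lip L (S2 h (U j)) /\ exists c, forall x, `|S2 h (U j) x| <= c).
Proof.
elim: j => [|j [_ [IH1 [c IH2]]]].
  have sol := solution_operatorP sol2 u0L u0b.
  split; first by split => //; exists b.
  split; first exact: solution_lip ctl2 sol L0 h0 u0L u0b.
  exact: solution_bounded sol h0.
have solj := solution_operatorP sol1 IH1 IH2.
have Ul : lip L (U j.+1) by exact: solution_lip ctl1 solj L0 h0 IH1 IH2.
have [c' Ub] : exists c, forall x, `|U j.+1 x| <= c by exact: solution_bounded solj h0.
have sol := solution_operatorP sol2 Ul Ub.
split; first by split => //; exists c'.
split; first exact: solution_lip ctl2 sol L0 h0 Ul Ub.
exact: solution_bounded sol h0.
Qed.

Let s (d : D * D) := s1 d.1 ++ s2 d.2.
Let f (d : D * D) := f1 d.1 + f2 d.2.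

(** [S2] acts first and [S1] on its outcome, each as a solution restarted at time 0;
    [super_step_comp] joins the two. *)
Lemma splitting_super_step j : super_step (fun X => G1 X + G2 X)
  (barrier_rate N B1 + barrier_rate N B2) h (U j) (U j.+1).
Proof.
have [[UL [c Ub]] [VL [c' Vb]]] := splitting_regular j.
have [_ B10 _ _ [e1 _]] := ctl1; have [_ B20 _ _ [e2 _]] := ctl2.
have st2 := solution_super_step B20 e2 (solution_operatorP sol2 UL Ub) h0 (lexx 0) (horizon_infty _).
have st1 := solution_super_step B10 e1 (solution_operatorP sol1 VL Vb) h0 (lexx 0) (horizon_infty _).
have i2 : (fun x => S2 0 (U j) x) = U j.
  by apply/funext => x; have [_ _ + _ _] := solution_operatorP sol2 UL Ub; exact.
have i1 : (fun x => S1 0 (S2 h (U j)) x) = S2 h (U j).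
  by apply/funext => x; have [_ _ + _ _] := solution_operatorP sol1 VL Vb; exact.
move: st1 st2; rewrite /= !add0r i1 i2 => st1 st2.
have := super_step_comp st2 st1.
rewrite [X in super_step _ X]addrC.
by rewrite (_ : (fun X => _ + _) = fun X => G1 X + G2 X)//; apply/funext => X; rewrite addrC.
Qed.

Lemma splitting_policy (k : R) (m n : nat) : 0 < k -> h = m.+1%:R * k ->
  forall j, (j <= n)%N -> forall x,
    let V := iter j (policy k m.+1 s f) u0 x in
    U j x <= V + j%:R * (walk_error N n1 B1 L h k + walk_error N n2 B2 L h k) /\
    V <= U j x + error_cst N (n1 + n2) (B1 + B2)
           (barrier_rate N B1 + barrier_rate N B2) L * (1 + j%:R * h) * h `^ (1 / 6).
Proof.
move=> k0 hE j jn x V; rewrite {}/V.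
have ctl := controls_prod ctl1 ctl2.
have [D0 B0 sn fF [GB GX]] := ctl.
split.
  elim: j jn x => [|j IH] jn x; first by rewrite mul0r addr0.
  have [VL [b' Vb]] := policy_iter m.+1 s D0 (ltW k0) fF u0b u0L j.
  have [[UL [c Ub]] [UL' [c' Ub']]] := splitting_regular j.
  set V := iter j _ u0 in VL Vb IH *.
  set w1 := walk_error N n1 _ _ _ _ in IH *.
  set w2 := walk_error N n2 _ _ _ _ in IH *.
  have st2 d y : S2 h (U j) y <= walk k (rep m.+1 (s2 d)) V y + (h * f2 d + j%:R * (w1 + w2) + w2).
    have sol := solution_operatorP sol2 UL Ub.
    have init z : S2 0 (U j) z <= V z + j%:R * (w1 + w2).
      by have [_ _ -> _ _] := sol; exact: IH (ltnW jn) z.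
    have := solution_le_walk ctl2 sol L0 k0 hE (lexx 0) (horizon_infty _) VL Vb init d y.
    by rewrite /= add0r !addrA.
  rewrite iterS -lerBlDr; apply: policy_ge => // d.
  have sol := solution_operatorP sol1 UL' Ub'.
  have init z : S1 0 (S2 h (U j)) z <= walk k (rep m.+1 (s2 d.2)) V z +
      (h * f2 d.2 + j%:R * (w1 + w2) + w2).
    by have [_ _ -> _ _] := sol; exact: st2.
  (* The datum is now the walk of the second control, so the walk of the first is applied to it, and
     [walk_rep_cat] merges both into the walk of the pair. *)
  have := solution_le_walk ctl1 sol L0 k0 hE (lexx 0) (horizon_infty _)
    (walk_lip _ _ VL) (walk_bound _ _ Vb) init d.1 x.
  rewrite /= add0r -walk_rep_cat -/(s d) -/w1 -hE -/V -[j.+1%:R]natr1.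
  by rewrite -[U j.+1 x]/(S1 h (S2 h (U j)) x) -[f d]/(f1 d.1 + f2 d.2); lra.
have GX' (X : 'M[R]_N) (c : R) :
    (forall d, - \sum_(t <- s d) quad_diag X t - f d <= c) -> G1 X + G2 X <= c.
  by move=> H; apply: (GX X).2 => d; rewrite tr_factor; exact: (H d).
exact: (@lower_iterate _ _ _ s f (B1 + B2) (F1 + F2) L _ k h b m (n1 + n2) n _ U u0
  D0 B0 L0 k0 hE (controls_entry ctl) (fun d => (sn d).2) fF GX'
  (fun i _ => @splitting_super_step i) u0L u0b (fun x => lexx _) j jn x).
Qed.

End splitting_scheme.

(** * Choice of the constants and conclusion *)

Unset Implicit Arguments.

Theorem corollary5p5 (R : realType) (N : nat) (N_gt0 : (0 < N)%N)
  (T : R) (T_gt0 : 0 < T)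
  (A : Type) (A_nonempty : inhabited A)
  (a1 a2 : A -> 'M[R]_N) (f1 f2 : A -> R)
  (a1_psd : forall alpha, psdmx (a1 alpha))
  (a2_psd : forall alpha, psdmx (a2 alpha))
  (a1_bounded : [bounded a1 alpha | alpha in setT])
  (a2_bounded : [bounded a2 alpha | alpha in setT])
  (f1_bounded : [bounded f1 alpha | alpha in setT])
  (f2_bounded : [bounded f2 alpha | alpha in setT])
  (S1 S2 : R -> ('rV[R]_N -> R) -> 'rV[R]_N -> R)
  (S1_sol : solution_operator (bellman a1 f1) S1)
  (S2_sol : solution_operator (bellman a2 f2) S2)
  (u0 : 'rV[R]_N -> R)
  (u0_bounded : [bounded u0 x | x in setT])
  (u0_lipschitz : [lipschitz u0 x | x in setT])
  (u : R * 'rV[R]_N -> R)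
  (u_sol : bounded_visc_solution (fun X => bellman a1 f1 X + bellman a2 f2 X)
             `]0, T] u0 u) :
  exists C : R, forall (nT : nat) (dt : R),
    0 < dt -> nT%:R * dt = T ->
    forall (n : nat) (x : 'rV[R]_N), (n <= nT)%N ->
      - C * dt `^ (1 / 14) <= u (n%:R * dt, x) - splitting S1 S2 dt u0 n x
        <= C * dt `^ (1 / 6).
Proof.
have [s1 [B1 [F1 ctl1]]] := bellman_controls A_nonempty a1_psd a1_bounded f1_bounded.
have [s2 [B2 [F2 ctl2]]] := bellman_controls A_nonempty a2_psd a2_bounded f2_bounded.
have ctl := controls_prod ctl1 ctl2.
have /lip_normE[L L0 u0L] := u0_lipschitz.
have /boundedE[b u0b] := u0_bounded.
pose K1 := error_cst N (N + N) (B1 + B2) (barrier_rate N (B1 + B2)) L.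
pose K2 := error_cst N (N + N) (B1 + B2) (barrier_rate N B1 + barrier_rate N B2) L.
have K10 : 0 <= K1 by exact: error_cst_ge0.
have K20 : 0 <= K2 by exact: error_cst_ge0.
have T0 : 0 <= T by exact: ltW.
pose C0 := 1 + (K1 + K2) * (1 + T).
have C00 : 0 <= C0 by rewrite addr_ge0// mulr_ge0// addr_ge0.
(* Both bounds are obtained with exponent 1/6; since [h <= T], the surplus [r] costs the factor
   [T^r] in the passage to 1/14. *)
pose r : R := 1 / 6 - 1 / 14.
exists (C0 * (1 + T `^ r)) => nT h h0 nTh n x nnT.
have nT0 : (0 < nT)%N.
  by rewrite lt0n; apply/negP => /eqP E; move: nTh; rewrite E mul0r => /eqP; rewrite lt_eqF.
have hT : h <= T by rewrite -nTh ler_peMl ?(ltW h0)// ler1n.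
have nhT : n%:R * h <= T by rewrite -nTh ler_pM2r// ler_nat.
pose w (n0 : nat) (B : R) := error_cst N n0 B (barrier_rate N B) L * (1 + h).
have w0 n0 B : 0 <= w n0 B.
  by rewrite mulr_ge0 ?error_cst_ge0// addr_ge0// ltW.
(* [Cm] may depend on [h] and [nT]: it only serves to choose the number of rounds, which does not
   enter the final constant. *)
pose Cm := nT%:R * (w (N + N)%N (B1 + B2) + (w N B1 + w N B2)).
have Cm0 : 0 <= Cm by rewrite mulr_ge0// !addr_ge0.
have p0 : 0 < h `^ (1 / 6) by exact: powR_gt0.
have [m mP] := small_step Cm0 h0 p0.
pose k := h / m.+1%:R; have k0 : 0 < k by rewrite divr_gt0.
have mk : h = m.+1%:R * k by rewrite mulrC divfK ?pnatr_eq0.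
have hor : horizon `]0, T] (nT%:R * h).
  right; rewrite nTh; split => r'; last by rewrite /= in_itv/= => /andP[].
  by move=> r0 rT; rewrite /= in_itv/= r0.
have [u1 u2] := solution_policy ctl u_sol L0 k0 mk nT0 hor u0L u0b nnT x.
have [v1 v2] := splitting_policy ctl1 ctl2 S1_sol S2_sol L0 u0L u0b h0 k0 mk nnT x.
set V := iter n _ u0 x in u1 u2 v1 v2.
set W := splitting _ _ _ _ _ _ in v1 v2 *.
have kp : 0 <= k `^ (1 / 6) by exact: powR_ge0.
have step a : 0 <= a -> a <= w (N + N)%N (B1 + B2) + (w N B1 + w N B2) ->
    n%:R * (a * k `^ (1 / 6)) <= h `^ (1 / 6).
  move=> a0 aw; apply: le_trans mP; rewrite mulrA -/k ler_wpM2r//.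
  by apply: ler_pM => //; rewrite ler_nat.
have e1 : n%:R * walk_error N (N + N) (B1 + B2) L h k <= h `^ (1 / 6).
  by apply: step; rewrite ?w0// lerDl addr_ge0.
have e2 : n%:R * (walk_error N N B1 L h k + walk_error N N B2 L h k) <= h `^ (1 / 6).
  rewrite -[_ + _](_ : (w N B1 + w N B2) * k `^ (1 / 6) = _); last by rewrite mulrDl.
  by apply: step; rewrite ?addr_ge0// lerDr.
have nh0 : 0 <= n%:R * h by rewrite mulr_ge0// ltW.
have nh1 : 1 + n%:R * h <= 1 + T by rewrite lerD2l.
have b1 : K1 * (1 + n%:R * h) * h `^ (1 / 6) <= K1 * (1 + T) * h `^ (1 / 6).
  by rewrite ler_pM2r// ler_wpM2l.
have b2 : K2 * (1 + n%:R * h) * h `^ (1 / 6) <= K2 * (1 + T) * h `^ (1 / 6).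
  by rewrite ler_pM2r// ler_wpM2l.
have c1 : 0 <= K1 * (1 + T) * h `^ (1 / 6).
  by rewrite !mulr_ge0// ?addr_ge0// ltW.
have c2 : 0 <= K2 * (1 + T) * h `^ (1 / 6).
  by rewrite !mulr_ge0// ?addr_ge0// ltW.
(* [u] and the scheme are compared with the same iterate [V] for pairs of controls: [u] is below it
   and the scheme above it up to errors; for [lo] the roles are exchanged. *)
have up : u (n%:R * h, x) - W <= C0 * h `^ (1 / 6).
  rewrite /C0; move: u1 v2 e1 b2 c1; rewrite -/K2; lra.
have lo : W - u (n%:R * h, x) <= C0 * h `^ (1 / 6).
  rewrite /C0; move: v1 u2 e2 b1 c2; rewrite /walk_error -/K1; lra.
have Tr : 0 <= T `^ r by exact: powR_ge0.
apply/andP; split; last first.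
  apply: (le_trans up); rewrite ler_pM2r// ler_peMr//.
  by rewrite lerDl.
have hh : h `^ (1 / 6) <= T `^ r * h `^ (1 / 14).
  rewrite (_ : 1 / 6 = r + 1 / 14 :> R); last by rewrite /r; lra.
  rewrite powRD; last by rewrite (gt_eqF h0) implybT.
  rewrite ler_wpM2r ?powR_ge0//.
  by rewrite ge0_ler_powR// ?nnegrE ?(ltW h0)// /r; lra.
rewrite mulNr lerNl opprB (le_trans lo)//.
rewrite -mulrA ler_wpM2l// (le_trans hh)// ler_wpM2r ?powR_ge0//.
by rewrite lerDr.
Qed.
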